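(* Let $\mathbb{T}$ be one of $\mathbb{R}$, $\mathbb{R}_+=[0,\infty)$ or $\mathbb{R}_{++}=(0,\infty)$, let $f,g:(0,\infty)\to(0,\infty)$ be continuous functions, and let $(X_t)_{t\in\mathbb{T}}$ be an $(f,g)$-dilatively stable process. (i) If $X$ is not the identically zero process and $f(T)=T^{\beta}$ for some $\beta\in\mathbb{R}$ and all $T>0$, then there exists a unique $\gamma\in\mathbb{R}$ such that $g(T)=T^{\gamma}$, $T>0$. (ii) If $X_1$ is not Gaussian, but has a Gaussian component in its Lévy–Khintchine representation, then there exist unique $\beta,\gamma\in\mathbb{R}$ such that $f(T)=T^{\beta}$, $T>0$, and $g(T)=T^{\gamma}$, $T>0$. (iii) If $\mathbb{E}(X_1^2)<\infty$, $\mathbb{E}(X_1)\neq0$ and $\operatorname{Var}(X_1)>0$, then there exist unique $\beta,\gamma\in\mathbb{R}$ such that $f(T)=T^{\beta}$, $T>0$, and $g(T)=T^{\gamma}$, $T>0$. (iv) If $X_1$ is not Gaussian, $\mathbb{E}(X_1^2)<\infty$ and $\operatorname{Var}(X_1)>0$, then there exist unique $\beta,\gamma\in\mathbb{R}$ such that $f(T)=T^{\beta}$, $T>0$, and $g(T)=T^{\gamma}$, $T>0$.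
   Context: All processes are real-valued and defined on a probability space $(\Omega,\mathcal{F},\mathbb{P})$; $\mathbb{N}$ denotes the set of positive integers. A process $(X_t)_{t\in\mathbb{T}}$ is called infinitely divisible if all its finite-dimensional distributions are infinitely divisible. For an infinitely divisible process and $k\in\mathbb{N}$, $t_1,\ldots,t_k\in\mathbb{T}$, the characteristic exponent of $(X_{t_1},\ldots,X_{t_k})$ is the unique continuous function $\psi_{t_1,\ldots,t_k}:\mathbb{R}^k\to\mathbb{C}$ with $\psi_{t_1,\ldots,t_k}(0,\ldots,0)=0$ and $$\mathbb{E}\left(e^{i\sum_{j=1}^k\theta_jX_{t_j}}\right)=e^{-\psi_{t_1,\ldots,t_k}(\theta_1,\ldots,\theta_k)}\quad\text{for all }\theta_1,\ldots,\theta_k\in\mathbb{R}.$$ For continuous functions $f,g:(0,\infty)\to(0,\infty)$, an infinitely divisible process $(X_t)_{t\in\mathbb{T}}$ is called $(f,g)$-dilatively stable if $$\psi_{Tt_1,\ldots,Tt_k}(\theta_1,\ldots,\theta_k)=g(T)\,\psi_{t_1,\ldots,t_k}\left(f(T)\theta_1,\ldots,f(T)\theta_k\right)$$ for all $T>0$, $k\in\mathbb{N}$, $\theta_1,\ldots,\theta_k\in\mathbb{R}$, $t_1,\ldots,t_k\in\mathbb{T}$. ''$X$ is not the identically zero process'' is understood in the distributional sense: there is $t\in\mathbb{T}$ with $\mathbb{P}(X_t=0)<1$. ''$X_1$ has a Gaussian component in its Lévy–Khintchine representation'' means that the Gaussian variance $\sigma^2$ in the Lévy–Khintchine triplet of the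 infinitely divisible random variable $X_1$ is strictly positive. *)

(* Defs.v *)
From HB Require Import structures.
From mathcomp Require Import all_boot all_order all_algebra.
From mathcomp Require Import complex.
From mathcomp Require Import all_classical all_reals all_analysis.

Set Implicit Arguments.
Unset Strict Implicit.
Unset Printing Implicit Defensive.

Import Order.TTheory GRing.Theory Num.Theory.
Import numFieldNormedType.Exports.

Local Open Scope classical_set_scope.
Local Open Scope ring_scope.
Local Open Scope complex_scope.

Definition cexp (R : realType) (z : R[i]) : R[i] :=
  (expR (complex.Re z) * cos (complex.Im z)) +i* (expR (complex.Re z) * sin (complex.Im z)).

Definition cintegral (R : realType) (d : measure_display)
    (Omega : measurableType d) (mu : {measure set Omega -> \bar R})
    (h : Omega -> R[i]) : R[i] :=
  (\int[mu]_(w in setT) complex.Re (h w)) +i* (\int[mu]_(w in setT) complex.Im (h w)).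

Definition random_vector (R : realType) (d : measure_display)
    (Omega : measurableType d) (P : probability Omega R)
    (k : nat) (X : 'I_k -> {RV P >-> R}) (w : Omega) : k.-tuple R :=
  [tuple X i w | i < k].

(* Taking some of the A j to be the full set gives the product rule over every
   subfamily. *)
Definition mutually_independent (R : realType) (d : measure_display)
    (Omega : measurableType d) (P : probability Omega R)
    (k n : nat) (Y : 'I_n -> {RV P >-> k.-tuple R}) : Prop :=
  forall A : 'I_n -> set (k.-tuple R), (forall j, measurable (A j)) ->
    P (\bigcap_(j in [set: 'I_n]) (Y j @^-1` A j)) =
    (\prod_(j < n) P (Y j @^-1` A j))%E.

Definition identically_distributed (R : realType) (d : measure_display)
    (Omega : measurableType d) (P : probability Omega R)
    (k n : nat) (Y : 'I_n -> {RV P >-> k.-tuple R}) : Prop :=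
  forall (i j : 'I_n) (A : set (k.-tuple R)), measurable A ->
    distribution P (Y i) A = distribution P (Y j) A.

(* The i.i.d. summands may live on another probability space. *)
Definition infinitely_divisible (R : realType) (k : nat)
    (mu : set (k.-tuple R) -> \bar R) : Prop :=
  forall n : nat, (0 < n)%N ->
    exists (d : measure_display) (Omega : measurableType d)
      (P : probability Omega R) (Y : 'I_n -> {RV P >-> k.-tuple R}),
      [/\ mutually_independent Y,
          identically_distributed Y &
          forall A : set (k.-tuple R), measurable A ->
            mu A = pushforward P
              (fun w => [tuple \sum_(j < n) tnth (Y j w) i | i < k]) A].

(* A process indexed by TT is a family over all reals of which only the
   members with index in TT are ever constrained. *)
Definition infinitely_divisible_process (R : realType) (d : measure_display)
    (Omega : measurableType d) (P : probability Omega R)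
    (TT : set R) (X : R -> {RV P >-> R}) : Prop :=
  forall (k : nat) (t : 'rV[R]_k), (0 < k)%N -> (forall i, TT (t ord0 i)) ->
    infinitely_divisible
      (pushforward P (random_vector (fun i => X (t ord0 i)))).

Definition characteristic_function (R : realType) (d : measure_display)
    (Omega : measurableType d) (P : probability Omega R)
    (k : nat) (X : 'I_k -> {RV P >-> R}) (theta : 'rV[R]_k) : R[i] :=
  cintegral P (fun w => cexp (0 +i* (\sum_(j < k) theta ord0 j * X j w))).

Definition is_characteristic_exponent (R : realType) (d : measure_display)
    (Omega : measurableType d) (P : probability Omega R)
    (k : nat) (X : 'I_k -> {RV P >-> R}) (psi : 'rV[R]_k -> R[i]) : Prop :=
  [/\ continuous (psi : 'rV[R]_k -> R[i]^o),
      psi 0 = 0 &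
      forall theta, characteristic_function X theta = cexp (- psi theta)].

(* psi k t is the characteristic exponent of (X_{t_1}, ..., X_{t_k}), which is
   determined by the properties in [is_characteristic_exponent]: two continuous
   logarithms of the same function that vanish at 0 coincide. *)
Definition dilatively_stable (R : realType) (d : measure_display)
    (Omega : measurableType d) (P : probability Omega R)
    (TT : set R) (f g : R -> R) (X : R -> {RV P >-> R}) : Prop :=
  infinitely_divisible_process TT X /\
  exists psi : forall k : nat, 'rV[R]_k -> 'rV[R]_k -> R[i],
    (forall (k : nat) (t : 'rV[R]_k), (0 < k)%N ->
       (forall i, TT (t ord0 i)) ->
       is_characteristic_exponent (fun i => X (t ord0 i)) (psi k t)) /\
    (forall (T : R) (k : nat) (theta t : 'rV[R]_k), 0 < T -> (0 < k)%N ->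
       (forall i, TT (t ord0 i)) ->
       psi k (T *: t) theta = (g T)%:C * psi k t (f T *: theta)).

(* [normal_prob m 0] is a junk value of the library (a uniform law), hence the
   separate case for degenerate Gaussian laws. *)
Definition is_gaussian (R : realType) (d : measure_display)
    (Omega : measurableType d) (P : probability Omega R)
    (X : {RV P >-> R}) : Prop :=
  exists m s : R, 0 <= s /\
    forall A : set R, measurable A ->
      distribution P X A = if s == 0 then \d_m A else normal_prob m s A.

Definition is_levy_measure (R : realType)
    (nu : {measure set (measurableTypeR R) -> \bar R}) : Prop :=
  nu [set 0] = 0%E /\
  (\int[nu]_(x in setT) (Num.min 1 ((x : R) ^+ 2))%:E < +oo)%E.

(* Levy-Khintchine formula with truncation function x 1_{|x| <= 1};
   s2 is the Gaussian variance.  The integrand is O(min(1, x^2)) for fixed theta,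
   hence nu-integrable. *)
Definition levy_khintchine_triplet (R : realType) (d : measure_display)
    (Omega : measurableType d) (P : probability Omega R) (X : {RV P >-> R})
    (b s2 : R) (nu : {measure set (measurableTypeR R) -> \bar R}) : Prop :=
  [/\ 0 <= s2,
      is_levy_measure nu &
      forall theta : R,
        cintegral P (fun w => cexp (0 +i* (theta * X w))) =
        cexp ((- (s2 * theta ^+ 2 / 2)) +i* (b * theta) +
          cintegral nu (fun x : R => cexp (0 +i* (theta * x)) - 1
            - (0 +i* (theta * x * \1_[set y : R | `|y| <= 1] x))))].

Definition has_gaussian_component (R : realType) (d : measure_display)
    (Omega : measurableType d) (P : probability Omega R)
    (X : {RV P >-> R}) : Prop :=
  exists (b s2 : R) (nu : {measure set (measurableTypeR R) -> \bar R}),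
    levy_khintchine_triplet X b s2 nu /\ 0 < s2.

Definition is_power (R : realType) (h : R -> R) (a : R) : Prop :=
  forall T : R, 0 < T -> h T = T `^ a.

(* Main.v *)
Require Import Defs.
From mathcomp Require Import all_boot all_order all_algebra.
From mathcomp Require Import complex.
From mathcomp Require Import all_classical all_reals all_analysis.
From mathcomp Require Import measurable_realfun.
From mathcomp Require Import ring lra.

(** Write psi for the characteristic exponent of X_1.  Applying the stability
    relation with T S in one step, or with S and then T, gives for all T, S
      psi (l u) = c psi u,  l = f(TS) / (f(T) f(S)),  c = g(T) g(S) / g(TS).
    Each part of the theorem is a rigidity statement: only l = c = 1 is
    possible.  Then f and g are multiplicative and continuous, hence powers
    ([power_laws_of_rigidity], [multiplicative_is_power]).

    The argument works with the modulus exp(- Re psi) and with the real and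
    imaginary parts of the characteristic function itself, so no branch of the
    logarithm has to be followed.

    Suppose X_1 has a finite second moment, mean m and positive variance.  Then
    Re psi(u) / u^2 tends to Var(X_1) / 2 as u -> 0, which forces c = l^2.  If
    l <> 1, iterating the scaling along l^n u -> 0 shows that Re psi is exactly
    quadratic; the same iteration applied to Im psi, which is - m u to first
    order, gives m = 0 and Im psi = 0 ([finite_variance_rigid]).  So X_1 would
    have the characteristic function of a centred Gaussian law, which is
    excluded by a nonzero mean as well as by non-Gaussianity.

    If X_1 has a Gaussian component s2 > 0, the Levy-Khintchine formula gives
    Re psi(u) = s2 u^2 / 2 + int (1 - cos(u x)) nu(dx), and the integral is
    o(u^2) as u -> oo, because x^2 /\ 1 is nu-integrable.  If l <> 1, the
    iteration now runs to infinity and shows that the integral vanishes for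
    every u; then nu = 0 and X_1 is Gaussian ([gaussian_component_rigid]).

    If f is assumed to be a power, then l = 1 from the start, and c = 1 as soon
    as the exponent of some X_t does not vanish identically
    ([nonzero_exponent], [power_law_of_f]).

    To recognise a Gaussian law from its characteristic function one needs the
    uniqueness theorem ([distribution_eq_of_char]).  A Gaussian bump is itself
    a mixture of cosines (its Fourier transform, computed from the differential
    equation phi' = - s^2 t phi), so the convolution of the law of X with a
    narrow Gaussian is determined by the characteristic function; letting the
    width tend to 0 recovers P(X < c). *)

Set Implicit Arguments.
Unset Strict Implicit.
Unset Printing Implicit Defensive.

Import Order.TTheory GRing.Theory Num.Theory.
Import numFieldNormedType.Exports.

Local Open Scope classical_set_scope.
Local Open Scope ring_scope.

(** * Trigonometric estimates *)

Lemma normr_sin_le (R : realType) (x : R) : `|sin x| <= `|x|.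
Proof.
wlog x0 : x / 0 <= x.
  move=> H; have [|x0] := leP 0 x; first exact: H.
  by rewrite -normrN -sinN -(normrN x); apply: H; rewrite oppr_ge0 ltW.
have [c _] : exists2 c, c \in `[0, x] & sin x - sin 0 = cos c * (x - 0).
  apply: (MVT_segment x0).
  by apply: continuous_subspaceT => y; exact: continuous_sin.
rewrite sin0 !subr0 => ->.
by rewrite normrM ler_piMl// cos_max.
Qed.

Lemma one_sub_cosE (R : realType) (x : R) : 1 - cos x = 2 * sin (x / 2) ^+ 2.
Proof.
have {1}-> : x = (x / 2) *+ 2 by rewrite -mulr_natr divfK.
by rewrite cos_mulr2n cos2sin2; ring.
Qed.

Lemma one_sub_cos_ge0 (R : realType) (x : R) : 0 <= 1 - cos x.
Proof. by rewrite subr_ge0 cos_le1. Qed.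

Lemma one_sub_cos_le (R : realType) (x : R) : 1 - cos x <= x ^+ 2 / 2.
Proof.
rewrite one_sub_cosE; have := normr_sin_le (x / 2).
rewrite -ler_sqr ?nnegrE// !real_normK ?num_real//.
by rewrite expr_div_n; lra.
Qed.

Lemma normr_sin_sub_le_cube (R : realType) (x : R) : `|sin x - x| <= `|x| ^+ 3.
Proof.
wlog x0 : x / 0 <= x.
  move=> H; have [|x0] := leP 0 x; first exact: H.
  have -> : sin x - x = - (sin (- x) - - x) by rewrite sinN; ring.
  by rewrite normrN -(normrN x); apply: H; rewrite oppr_ge0 ltW.
have [c] : exists2 c, c \in `[0, x] & (sin x - x) - (sin 0 - 0) = (cos c - 1) * (x - 0).
  apply: (@MVT_segment _ (fun x => sin x - x) (fun x => cos x - 1) _ _ x0).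
  apply: continuous_subspaceT => y; apply: cvgB; [exact: continuous_sin|exact: cvg_id].
rewrite sin0 !subr0 in_itv/= => /andP[c0 cx] ->.
rewrite normrM distrC (ger0_norm (one_sub_cos_ge0 _)) (ger0_norm x0) exprSr ler_wpM2r//.
apply: le_trans (one_sub_cos_le _) _.
have : c ^+ 2 <= x ^+ 2 by rewrite ler_sqr ?nnegrE.
by have := sqr_ge0 c; lra.
Qed.

Lemma normr_sin_sub_le (R : realType) (x : R) : `|sin x - x| <= 2 * x ^+ 2.
Proof.
have [x1|x1] := leP `|x| 1.
  apply: le_trans (normr_sin_sub_le_cube _) _.
  rewrite -(real_normK (num_real x)) exprSr mulrC ler_wpM2r ?sqr_ge0//.
  by rewrite (le_trans x1)// ler1n.
apply: le_trans (ler_normB _ _) _; apply: (@le_trans _ _ (`|x| + `|x|)).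
  by rewrite lerD2r normr_sin_le.
rewrite -(real_normK (num_real x)).
have : `|x| <= `|x| ^+ 2 by rewrite expr2 ler_peMl// ltW.
lra.
Qed.

(** Second order Taylor bound without derivatives: 1 - cos x is
    2 sin^2(x / 2), and a^2 - b^2 = (a - b)(a + b) with a = sin(x / 2) and
    b = x / 2. *)
Lemma one_sub_cos_quad_approx (R : realType) (x : R) :
  `|1 - cos x - x ^+ 2 / 2| <= x ^+ 4.
Proof.
have -> : 1 - cos x - x ^+ 2 / 2 = 2 * ((sin (x / 2) - x / 2) * (sin (x / 2) + x / 2)).
  by rewrite one_sub_cosE; field.
rewrite normrM ger0_norm// normrM.
have h1 := normr_sin_sub_le_cube (x / 2).
have half : `|2^-1| = 2^-1 :> R by rewrite ger0_norm.
have h2 : `|sin (x / 2) + x / 2| <= `|x|.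
  apply: le_trans (ler_normD _ _) _; apply: (@le_trans _ _ (`|x / 2| + `|x / 2|)).
    by rewrite lerD2r normr_sin_le.
  by rewrite normrM half; lra.
have h3 : `|x / 2| ^+ 3 = `|x| ^+ 3 / 8.
  by rewrite normrM half; field.
have -> : x ^+ 4 = `|x| ^+ 3 * `|x| by rewrite -exprSr -normrX ger0_norm// exprn_even_ge0.
have : `|sin (x / 2) - x / 2| * `|sin (x / 2) + x / 2| <= `|x| ^+ 3 / 8 * `|x|.
  by apply: ler_pM => //; rewrite -h3.
have : 0 <= `|x| ^+ 3 * `|x| by rewrite mulr_ge0// exprn_ge0.
lra.
Qed.

(** * Continuous multiplicative functions are powers *)

(** In logarithmic coordinates h becomes a continuous additive function L.
    The difference D(x) = L(x) - x L(1) is additive and has period 1, hence is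
    bounded; since D(n x) = n D(x), it vanishes. *)
Lemma multiplicative_is_power (R : realType) (h : R -> R) :
  {within `]0, +oo[%classic, continuous h} ->
  (forall x, 0 < x -> 0 < h x) ->
  (forall x y, 0 < x -> 0 < y -> h (x * y) = h x * h y) ->
  exists a, is_power h a.
Proof.
move=> ch h0 hM.
pose L x := ln (h (expR x)).
have LD x y : L (x + y) = L x + L y.
  by rewrite /L expRD hM ?expR_gt0// lnM// posrE h0 ?expR_gt0.
have cL : continuous L.
  move=> x; apply: continuous_comp; last first.
    by apply: continuous_ln; rewrite h0 ?expR_gt0.
  apply: continuous_comp; first exact: continuous_expR.
  move: ch; rewrite continuous_open_subspace; last exact: interval_open.
  by apply; rewrite inE/= in_itv/= andbT expR_gt0.
pose D x := L x - x * L 1.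
have DD x y : D (x + y) = D x + D y by rewrite /D LD; ring.
have D1 : D 1 = 0 by rewrite /D mul1r subrr.
have D0 : D 0 = 0 by apply: (addrI (D 0)); rewrite -DD !addr0.
have DN x : D (- x) = - D x by apply: (addrI (D x)); rewrite -DD !subrr.
have Dn x (n : nat) : D (n%:R * x) = n%:R * D x.
  elim: n => [|n IH]; first by rewrite !mul0r.
  by rewrite -natr1 !mulrDl DD IH !mul1r.
have cD : continuous D.
  move=> x; apply: cvgB; first exact: cL.
  by apply: cvgM; [exact: cvg_id|exact: cvg_cst].
have [c _ Mc] : exists2 c, c \in `[0%R, 1%R] & forall t, t \in `[0%R, 1%R] -> `|D t| <= `|D c|.
  apply: (@EVT_max _ (fun x => `|D x|)) => //.
  by apply: continuous_subspaceT => x; apply: cvg_norm; exact: cD.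
have bD x : 0 <= x -> `|D x| <= `|D c|.
  move=> x0; have /andP[kx xk] := truncn_itv x0; set k := Num.truncn x in kx xk.
  have -> : D x = D (x - k%:R) by rewrite DD DN -[k%:R]mulr1 Dn D1 mulr0 subr0.
  apply: Mc; rewrite in_itv/= subr_ge0 kx lerBlDl -natr1 in xk *.
  by rewrite natr1 ltW// -natr1.
have Dx0 x : 0 <= x -> D x = 0.
  move=> x0; apply/eqP; rewrite -normr_eq0; apply/eqP/le_anti; rewrite normr_ge0 andbT.
  rewrite leNgt; apply/negP => Dx.
  have := bD ((Num.truncn (`|D c| / `|D x|)).+1%:R * x) (mulr_ge0 (ler0n _ _) x0).
  rewrite Dn normrM normr_nat -ler_pdivlMr// leNgt.
  by rewrite truncnS_gt.
exists (L 1) => T T0.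
have DT : D (ln T) = 0.
  have [l0|l0] := leP 0 (ln T); first exact: Dx0.
  by apply/eqP; rewrite -oppr_eq0 -DN Dx0// oppr_ge0 ltW.
move/eqP : DT; rewrite /D subr_eq0 /L lnK ?posrE// => /eqP hT.
by rewrite -[LHS]lnK ?posrE ?h0// hT /powR gt_eqF// mulrC.
Qed.

Lemma is_power_inj (R : realType) (h : R -> R) (a b : R) :
  is_power h a -> is_power h b -> a = b.
Proof.
move=> ha hb; have e0 : 0 < expR 1 :> R by exact: expR_gt0.
have := ha _ e0; rewrite (hb _ e0) /powR gt_eqF// expRK !mulr1.
by move/expR_inj.
Qed.

(** * Functions with a scaling relation *)

Lemma cvg0_of_near_norm_le (R : realType) (a b : nat -> R) :
  (\forall n \near \oo, `|a n| <= b n) -> b n @[n --> \oo] --> 0 ->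
  a n @[n --> \oo] --> 0.
Proof.
move=> ab b0; apply: norm_cvg0.
have ab' : \forall n \near \oo, cst 0 n <= `|a n| <= b n.
  by near=> n; rewrite normr_ge0/=; near: n.
exact: (squeeze_cvgr ab' (cvg_cst _) b0).
Unshelve. all: by end_near. Qed.

Lemma cvg0_of_norm_le (R : realType) (a b : nat -> R) :
  (forall n, `|a n| <= b n) -> b n @[n --> \oo] --> 0 -> a n @[n --> \oo] --> 0.
Proof. by move=> ab; apply: cvg0_of_near_norm_le; exact: nearW. Qed.

Lemma cvg_expr_lt1 (R : realType) (l : R) : 0 < l < 1 -> l ^+ n @[n --> \oo] --> 0.
Proof. by move=> /andP[l0 l1]; apply: cvg_expr; rewrite ger0_norm// ltW. Qed.

(** Along the orbit l^n x the quotient h(y) / y^2 is constant. *)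
Lemma scaling_ratio_const (R : realType) (h : R -> R) (l L x : R) :
  l != 0 -> x != 0 -> (forall y, h (l * y) = l ^+ 2 * h y) ->
  h (l ^+ n * x) / (l ^+ n * x) ^+ 2 @[n --> \oo] --> L ->
  h x = L * x ^+ 2.
Proof.
move=> l0 x0 hl hL.
have hn n : h (l ^+ n * x) / (l ^+ n * x) ^+ 2 = h x / x ^+ 2.
  elim: n => [|n <-]; first by rewrite expr0 mul1r.
  have ln : l ^+ n != 0 by rewrite expf_neq0.
  rewrite exprS -mulrA hl; field.
  by rewrite l0 x0 ln.
have : h x / x ^+ 2 = L.
  have hE : (fun n => h (l ^+ n * x) / (l ^+ n * x) ^+ 2) = cst (h x / x ^+ 2).
    exact/funext.
  by move: hL; rewrite hE => hL; exact: (cvg_unique (@norm_hausdorff _ R^o) (cvg_cst _) hL).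
by move=> <-; rewrite divfK// expf_neq0.
Qed.

(** The quotient h(y) / y^2 is multiplied by c / l^2 at each step of the
    orbit l^n x, which is compatible with a nonzero limit only if c = l^2. *)
Lemma scaling_factor_eq (R : realType) (h : R -> R) (l c L x : R) :
  l != 0 -> x != 0 -> L != 0 -> (forall y, h (l * y) = c * h y) ->
  h (l ^+ n * x) / (l ^+ n * x) ^+ 2 @[n --> \oo] --> L ->
  c = l ^+ 2.
Proof.
move=> l0 x0 L0 hl hL.
have hS n : h (l ^+ n.+1 * x) / (l ^+ n.+1 * x) ^+ 2 =
    c / l ^+ 2 * (h (l ^+ n * x) / (l ^+ n * x) ^+ 2).
  have ln : l ^+ n != 0 by rewrite expf_neq0.
  rewrite exprS -mulrA hl; field.
  by rewrite l0 x0 ln.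
have : L = c / l ^+ 2 * L.
  have hE : (fun n => h (l ^+ n.+1 * x) / (l ^+ n.+1 * x) ^+ 2) =
      (fun n => c / l ^+ 2 * (h (l ^+ n * x) / (l ^+ n * x) ^+ 2)).
    exact/funext.
  have := hL; rewrite -cvg_shiftS hE => hL'; apply: (cvg_unique (@norm_hausdorff _ R^o) hL').
  by apply: cvgM => //; exact: cvg_cst.
rewrite -{1}[L]mul1r => /(mulIf L0) cl.
by rewrite -[RHS]mul1r cl divfK// expf_neq0.
Qed.

(** * Integrals of trigonometric functions *)

(** Real-valued form of dominated convergence, for pointwise limits
    that hold everywhere. *)
Lemma Rdominated_convergence d (T : measurableType d) (R : realType)
    (mu : {measure set T -> \bar R}) (f_ : nat -> T -> R) (f g : T -> R) :
  (forall n, measurable_fun setT (f_ n)) -> measurable_fun setT f ->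
  (forall x, f_ n x @[n --> \oo] --> f x) ->
  mu.-integrable setT (EFin \o g) ->
  (forall n x, `|f_ n x| <= g x) ->
  mu.-integrable setT (EFin \o f) /\
  \int[mu]_x f_ n x @[n --> \oo] --> \int[mu]_x f x.
Proof.
move=> mf_ mf ff ig fg.
have ff' x : setT x -> (f_ n x)%:E @[n --> \oo] --> (f x)%:E.
  by move=> _; apply: cvg_EFin; [exact: nearW|exact: ff].
have [intf _ cf] := @dominated_convergence _ _ _ mu setT measurableT
  (fun n x => (f_ n x)%:E) (EFin \o f) (EFin \o g)
  (fun n => (measurable_EFinP _ _).2 (mf_ n)) ((measurable_EFinP _ _).2 mf)
  (aeW _ ff') ig
  (aeW _ (fun x n _ => fg n x)).
split => //; apply: fine_cvg.
by rewrite fineK//; exact: integrable_fin_num.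
Qed.

Lemma measurable_cosZ d (T : measurableType d) (R : realType)
    (X : T -> R) (t : R) : measurable_fun setT X ->
  measurable_fun setT (fun w => cos (t * X w)).
Proof.
move=> mX; apply: measurableT_comp; last exact: measurable_funM.
exact: (continuous_measurable_fun (@continuous_cos R)).
Qed.

Lemma measurable_sinZ d (T : measurableType d) (R : realType)
    (X : T -> R) (t : R) : measurable_fun setT X ->
  measurable_fun setT (fun w => sin (t * X w)).
Proof.
move=> mX; apply: measurableT_comp; last exact: measurable_funM.
exact: (continuous_measurable_fun (@continuous_sin R)).
Qed.

Lemma integrable_cos d (T : measurableType d) (R : realType)
   (P : probability T R) (X : {RV P >-> R}) (t : R) :
   P.-integrable setT (EFin \o (fun w => cos (t * X w))).
Proof.
apply: measurable_bounded_integrable.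
- by [].
- by rewrite -ge0_fin_numE ?fin_num_measure.
- exact: measurable_cosZ.
- by exists 1; split => // x x1 w _; apply: le_trans (ltW x1); exact: cos_max.
Qed.

Lemma integrable_sin d (T : measurableType d) (R : realType)
   (P : probability T R) (X : {RV P >-> R}) (t : R) :
   P.-integrable setT (EFin \o (fun w => sin (t * X w))).
Proof.
apply: measurable_bounded_integrable.
- by [].
- by rewrite -ge0_fin_numE ?fin_num_measure.
- exact: measurable_sinZ.
- by exists 1; split => // x x1 w _; apply: le_trans (ltW x1); exact: sin_max.
Qed.

(** A nonnegative integrand with integral 0 vanishes almost everywhere, so
    almost surely cos(Y / (n + 1)) = 1 for all n; for n large Y / (n + 1) is
    smaller than a period, and Y = 0. *)
Lemma ae_eq0_of_cos d (T : measurableType d) (R : realType)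
    (mu : {measure set T -> \bar R}) (Y : T -> R) :
  measurable_fun setT Y ->
  (forall t, (\int[mu]_x (1 - cos (t * Y x))%:E = 0)%E) ->
  {ae mu, forall x, Y x = 0}.
Proof.
move=> mY hY.
have ae1 n : {ae mu, forall x, 1 - cos (n.+1%:R^-1 * Y x) = 0}.
  have mc : measurable_fun setT (fun x => (1 - cos (n.+1%:R^-1 * Y x))%:E).
    by apply/measurable_EFinP/measurable_funB => //; exact: measurable_cosZ.
  have : (\int[mu]_x `|(1 - cos (n.+1%:R^-1 * Y x))%:E| = 0)%E.
    rewrite -[RHS](hY n.+1%:R^-1); apply: eq_integral => x _.
    by rewrite gee0_abs// lee_fin one_sub_cos_ge0.
  move/(ae_eq_integral_abs mu measurableT mc).1.
  by apply: filterS => x /(_ I) /= [].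
have := ae_foralln ae1.
apply: filterS => x hx; apply/eqP/negPn/negP => Yx.
pose n := Num.truncn `|Y x|; pose w := n.+1%:R^-1 * Y x / 2.
have w1 : `|w| < 1.
  rewrite /w !normrM (@ger0_norm _ n.+1%:R^-1)// (@ger0_norm _ 2^-1)//.
  rewrite ltr_pdivrMr// mul1r ltr_pdivrMl//; apply: lt_le_trans (truncnS_gt _) _.
  by rewrite ler_peMr// ler1n.
have w0 : w != 0 by rewrite /w !mulf_neq0// ?invr_eq0 pnatr_eq0.
have sw : sin w = 0.
  have := hx n; rewrite one_sub_cosE => /eqP; rewrite mulf_eq0 pnatr_eq0/=.
  by rewrite sqrf_eq0 => /eqP.
have := normr_sin_sub_le_cube w; rewrite sw sub0r normrN leNgt => /negP; apply.
rewrite exprS gtr_pMr ?normr_gt0//.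
by rewrite expr_lt1 ?normr_gt0.
Qed.

(** * The exponent near 0 under a finite second moment *)

Section second_moment.
Context d (Omega : measurableType d) (R : realType) (P : probability Omega R).
Variable X : {RV P >-> R}.
Hypothesis X2 : P.-integrable setT (EFin \o (fun w => X w ^+ 2)).

Let C t := \int[P]_w cos (t * X w).
Let S t := \int[P]_w sin (t * X w).
Let m := \int[P]_w X w.
Let v := \int[P]_w (X w ^+ 2).

Lemma integrable_of_sqr : P.-integrable setT (EFin \o X).
Proof.
have i1 : P.-integrable setT (EFin \o (fun w => 1 + X w ^+ 2)).
  rewrite (_ : EFin \o _ = (fun x => (cst 1%:E x + (EFin \o (fun w => (X w ^+ 2)%R)) x)%E))//.
  by apply: integrableD => //; apply: finite_measure_integrable_cst.
apply: le_integrable i1 => //.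
  exact/measurable_EFinP.
move=> w _; rewrite lee_fin [leRHS]ger0_norm ?addr_ge0 ?sqr_ge0//.
rewrite -(real_normK (num_real (X w))).
by have := sqr_ge0 (`|X w| - 1); have := normr_ge0 (X w); nra.
Qed.

Variable u : nat -> R.
Hypothesis u0 : forall n, u n != 0.
Hypothesis u_cvg : u n @[n --> \oo] --> 0.

(** The quotients (1 - cos(u X)) / u^2 tend to X^2 / 2 and are dominated by X^2. *)
Lemma cos_second_order : (1 - C (u n)) / u n ^+ 2 @[n --> \oo] --> v / 2.
Proof.
have bound n w : `|(1 - cos (u n * X w)) / u n ^+ 2| <= X w ^+ 2.
  have un : 0 < u n ^+ 2 by rewrite exprn_even_gt0//= u0.
  rewrite ger0_norm ?divr_ge0 ?one_sub_cos_ge0 ?sqr_ge0// ler_pdivrMr//.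
  apply: le_trans (one_sub_cos_le _) _; rewrite exprMn.
  by have := mulr_ge0 (sqr_ge0 (u n)) (sqr_ge0 (X w)); lra.
have mf n : measurable_fun setT (fun w => (1 - cos (u n * X w)) / u n ^+ 2).
  by apply: measurable_funM => //; apply: measurable_funB => //; apply: measurable_cosZ.
have ptw w : (1 - cos (u n * X w)) / u n ^+ 2 @[n --> \oo] --> X w ^+ 2 / 2.
  apply/subr_cvg0.
  apply: (@cvg0_of_norm_le _ _ (fun n => u n * u n * X w ^+ 4)) => [n|].
  - have un : 0 < u n ^+ 2 by rewrite exprn_even_gt0//= u0.
    have -> : (1 - cos (u n * X w)) / u n ^+ 2 - X w ^+ 2 / 2 =
       (1 - cos (u n * X w) - (u n * X w) ^+ 2 / 2) / u n ^+ 2.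
      by field; exact: u0.
    rewrite normf_div (ger0_norm (ltW un)) ler_pdivrMr//.
    apply: le_trans (one_sub_cos_quad_approx _) _.
    by rewrite le_eqVlt; apply/orP; left; apply/eqP; ring.
  - rewrite -[X in _ --> X](mul0r (X w ^+ 4)) -[in X in _ --> X](mul0r 0).
    by apply: cvgM; [apply: cvgM|exact: cvg_cst].
have mX2 : measurable_fun setT (fun w => X w ^+ 2 / 2).
  by apply: measurable_funM => //; exact: measurable_funX.
have [_] := Rdominated_convergence mf mX2 ptw X2 bound.
have iC t := integrable_cos X t.
have i1 : P.-integrable setT (EFin \o cst 1) by exact: finite_measure_integrable_cst.
have P1 : fine ((P : {measure set Omega -> \bar R}) setT) = 1.
  exact: (congr1 fine (probability_setT P)).
rewrite RintegralZr//.
under eq_fun => n.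
  rewrite RintegralZr; first last.
  - exact: (integrableB measurableT i1 (iC (u n))).
  - by [].
  rewrite RintegralB// Rintegral_cst// P1 mulr1.
  over.
by [].
Qed.

(** The quotients (sin(u X) - u X) / u^2 tend to 0 and are dominated by 2 X^2. *)
Lemma sin_second_order :
  (S (u n) - u n * m) / u n ^+ 2 @[n --> \oo] --> 0.
Proof.
have bound n w : `|(sin (u n * X w) - u n * X w) / u n ^+ 2| <= 2 * X w ^+ 2.
  have un : 0 < u n ^+ 2 by rewrite exprn_even_gt0//= u0.
  rewrite normf_div (ger0_norm (ltW un)) ler_pdivrMr//.
  apply: le_trans (normr_sin_sub_le _) _; rewrite exprMn.
  by rewrite le_eqVlt; apply/orP; left; apply/eqP; ring.
have mf n : measurable_fun setT (fun w => (sin (u n * X w) - u n * X w) / u n ^+ 2).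
  apply: measurable_funM => //; apply: measurable_funB; first exact: measurable_sinZ.
  exact: measurable_funM.
have ptw w : (sin (u n * X w) - u n * X w) / u n ^+ 2 @[n --> \oo] --> 0.
  apply: (@cvg0_of_norm_le _ _ (fun n => `|u n| * `|X w| ^+ 3)) => [n|].
  - have un : 0 < u n ^+ 2 by rewrite exprn_even_gt0//= u0.
    rewrite normf_div (ger0_norm (ltW un)) ler_pdivrMr//.
    apply: le_trans (normr_sin_sub_le_cube _) _; rewrite normrM -(real_normK (num_real (u n))).
    by rewrite le_eqVlt; apply/orP; left; apply/eqP; ring.
  - rewrite -[X in _ --> X](mul0r (`|X w| ^+ 3)).
    by apply: cvgM; [rewrite -(normr0 R); exact: cvg_norm|exact: cvg_cst].
have i2 : P.-integrable setT (EFin \o (fun w => 2 * X w ^+ 2)).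
  rewrite (_ : _ \o _ = (fun x => 2%:E * (EFin \o (fun w => (X w ^+ 2)%R)) x)%E)//.
  exact: integrableZl.
have iX := integrable_of_sqr.
have m0 : measurable_fun setT (fun _ : Omega => 0 : R) by exact: measurable_cst.
have [_] := Rdominated_convergence mf m0 ptw i2 bound.
have iS t := integrable_sin X t.
have iuX t : P.-integrable setT (EFin \o (fun w => t * X w)).
  rewrite (_ : _ \o _ = (fun x => t%:E * (EFin \o X) x)%E)//.
  exact: integrableZl.
rewrite Rintegral_cst// mul0r.
under eq_fun => n.
  rewrite RintegralZr; first last.
  - exact: (integrableB measurableT (iS (u n)) (iuX (u n))).
  - by [].
  rewrite RintegralB// RintegralZl//.
  over.
by [].
Qed.

Lemma sin_first_order : S (u n) / u n @[n --> \oo] --> m.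
Proof.
have -> : (fun n => S (u n) / u n) =
    (fun n => u n * ((S (u n) - u n * m) / u n ^+ 2) + m).
  by apply/funext => n; field; exact: u0.
rewrite -[X in _ --> X]add0r; apply: cvgD; last exact: cvg_cst.
by rewrite -[X in _ --> X](mulr0 0); apply: cvgM => //; exact: sin_second_order.
Qed.

Variables r i : R -> R.
Hypothesis Cr : forall t, C t = expR (- r t) * cos (i t).
Hypothesis Sr : forall t, S t = - (expR (- r t) * sin (i t)).

(** Here w = |phi|^2 = exp(- 2 r).  The expansions of the real and imaginary
    parts of phi give (1 - w) / u^2 -> v - m^2, and the logarithm is removed by
    1 - w <= 2 r <= (1 - w) / w. *)
Lemma log_modulus_second_order :
  r (u n) / u n ^+ 2 @[n --> \oo] --> (v - m ^+ 2) / 2.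
Proof.
pose w n := C (u n) ^+ 2 + S (u n) ^+ 2.
have wE n : w n = expR (- (2 * r (u n))).
  rewrite /w Cr Sr sqrrN !exprMn -mulrDr cos2Dsin2 mulr1 -expRM_natl.
  by congr expR; ring.
have cC : C (u n) @[n --> \oo] --> (1 : R).
  have -> : (fun n => C (u n)) = (fun n => 1 - u n * (u n * ((1 - C (u n)) / u n ^+ 2))).
    by apply/funext => n; field; exact: u0.
  rewrite -[X in _ --> X]subr0; apply: cvgB; first exact: cvg_cst.
  rewrite -[X in _ --> X](mul0r (0 * (v / 2))); apply: cvgM => //; apply: cvgM => //.
  exact: cos_second_order.
have cS : S (u n) @[n --> \oo] --> (0 : R).
  have -> : (fun n => S (u n)) = (fun n => u n * (S (u n) / u n)).
    by apply/funext => n; field; exact: u0.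
  rewrite -[X in _ --> X](mul0r m); apply: cvgM => //; exact: sin_first_order.
have cw : w n @[n --> \oo] --> (1 : R).
  rewrite [X in _ --> X](_ : _ = 1 * 1 + 0 * 0); last by rewrite mulr1 mulr0 addr0.
  by apply: cvgD; apply: cvgM.
have cq : (1 - w n) / u n ^+ 2 @[n --> \oo] --> v - m ^+ 2.
  have -> : (fun n => (1 - w n) / u n ^+ 2) = (fun n =>
      (1 - C (u n)) / u n ^+ 2 * (1 + C (u n)) - S (u n) / u n * (S (u n) / u n)).
    by apply/funext => n; rewrite /w; field; exact: u0.
  rewrite [X in _ --> X](_ : _ = v / 2 * (1 + 1) - m * m); last by field.
  apply: cvgB; apply: cvgM; try exact: sin_first_order.
    exact: cos_second_order.
  by apply: cvgD => //; exact: cvg_cst.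
have c2 : 2 * (r (u n)) / u n ^+ 2 @[n --> \oo] --> v - m ^+ 2.
  have cqw : (1 - w n) / u n ^+ 2 / w n @[n --> \oo] --> v - m ^+ 2.
    rewrite -[X in _ --> X]mulr1 -[in X in _ --> X]invr1; apply: cvgM => //.
    by apply: cvgV => //; exact: oner_neq0.
  suff rw : \forall n \near \oo, (1 - w n) / u n ^+ 2 <= 2 * r (u n) / u n ^+ 2
      <= (1 - w n) / u n ^+ 2 / w n by exact: (squeeze_cvgr rw cq cqw).
  apply: nearW => n; have wn : 0 < w n by rewrite wE expR_gt0.
  have un : 0 <= (u n ^+ 2)^-1 by rewrite invr_ge0 sqr_ge0.
  apply/andP; split.
    apply: ler_wpM2r => //.
    by rewrite wE; have := expR_ge1Dx (- (2 * r (u n))); lra.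
  rewrite [leRHS]mulrAC; apply: ler_wpM2r => //; rewrite ler_pdivlMr//.
  have : expR (2 * r (u n)) * w n = 1 by rewrite wE -expRD subrr expR0.
  by have := expR_ge1Dx (2 * r (u n)); nra.
have -> : (fun n => r (u n) / u n ^+ 2) = (fun n => 2 * r (u n) / u n ^+ 2 / 2).
  by apply/funext => n; field; exact: u0.
by apply: cvgM => //; exact: cvg_cst.
Qed.

End second_moment.

(** * Rigidity under a finite variance *)

Section finite_variance_rigidity.
Context d (Omega : measurableType d) (R : realType) (P : probability Omega R).
Variable X : {RV P >-> R}.
Hypothesis X2 : P.-integrable setT (EFin \o (fun w => X w ^+ 2)).

Let C t := \int[P]_w cos (t * X w).
Let S t := \int[P]_w sin (t * X w).
Let m := \int[P]_w X w.
Let v := \int[P]_w (X w ^+ 2).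

Hypothesis var_gt0 : 0 < v - m ^+ 2.

Variables r i : R -> R.
Hypothesis Cr : forall t, C t = expR (- r t) * cos (i t).
Hypothesis Sr : forall t, S t = - (expR (- r t) * sin (i t)).

Variables (l c : R).
Hypothesis rl : forall t, r (l * t) = c * r t.
Hypothesis il : forall t, i (l * t) = c * i t.

Let L := (v - m ^+ 2) / 2.
Let L0 : 0 < L. Proof. by rewrite divr_gt0. Qed.

Let u0 t : t != 0 -> 0 < l < 1 -> forall n, l ^+ n * t != 0.
Proof. by move=> t0 /andP[l0 _] n; rewrite mulf_neq0// expf_neq0// gt_eqF. Qed.

Let u_cvg t : 0 < l < 1 -> l ^+ n * t @[n --> \oo] --> 0.
Proof.
move=> l01; rewrite -[X in _ --> X](mul0r t).
by apply: cvgM; [exact: cvg_expr_lt1|exact: cvg_cst].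
Qed.

(** The scaling first gives c = l^2 and r(t) = L t^2.  On the orbit
    l^n t the phase i is multiplied by l^(2 n) whereas the imaginary part of
    phi behaves like m l^n t, so m = 0.  With m = 0 that imaginary part is
    o(l^(2 n)), hence i(t) = 0 as well. *)
Lemma finite_variance_rigid_lt1 : 0 < l < 1 ->
  m = 0 /\ forall t, C t = expR (- (v / 2 * t ^+ 2)) /\ S t = 0.
Proof.
move=> l01; have /andP[l0 l1] := l01.
have lne : l != 0 by rewrite gt_eqF.
have rlim t : t != 0 -> r (l ^+ n * t) / (l ^+ n * t) ^+ 2 @[n --> \oo] --> L.
  move=> t0.
  by apply: (log_modulus_second_order X2 (u0 t0 l01) (u_cvg t l01) Cr Sr).
have cl : c = l ^+ 2.
  apply: (scaling_factor_eq lne (oner_neq0 R) _ rl (rlim _ (oner_neq0 R))).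
  by rewrite gt_eqF.
have rE t : t != 0 -> r t = L * t ^+ 2.
  by move=> t0; apply: (scaling_ratio_const lne t0 _ (rlim t t0)) => y; rewrite rl cl.
have r_ge0 t : t != 0 -> 0 <= r t.
  by move=> t0; rewrite rE// mulr_ge0 ?sqr_ge0// ltW.
have iln t n : i (l ^+ n * t) = (l ^+ n) ^+ 2 * i t.
  elim: n => [|n IH]; first by rewrite expr0 expr1n !mul1r.
  by rewrite exprS -mulrA il IH cl; ring.
have Sle t n : t != 0 -> `|S (l ^+ n * t)| <= (l ^+ n) ^+ 2 * `|i t|.
  move=> t0; rewrite Sr normrN normrM (@ger0_norm _ (expR _)) ?expR_ge0//.
  apply: (@le_trans _ _ (1 * `|i (l ^+ n * t)|)).
    apply: ler_pM; rewrite ?expR_ge0 ?normr_ge0//.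
      by rewrite -[leRHS]expR0 ler_expR oppr_le0 r_ge0// u0.
    exact: normr_sin_le.
  by rewrite mul1r iln normrM (@ger0_norm _ (_ ^+ 2)) ?sqr_ge0.
have m0 : m = 0.
  have h1 := sin_first_order X2 (u0 (oner_neq0 R) l01) (u_cvg 1 l01).
  have h2 : (fun n => S (l ^+ n * 1) / (l ^+ n * 1)) @ \oo --> (0 : R).
    apply: (@cvg0_of_norm_le _ _ (fun n => l ^+ n * `|i 1|)) => [n|]; last first.
      rewrite -[X in _ --> X](mul0r `|i 1|).
      by apply: cvgM; [exact: cvg_expr_lt1|exact: cvg_cst].
    have ln : 0 < l ^+ n by rewrite exprn_gt0.
    rewrite mulr1 normf_div (ger0_norm (ltW ln)) ler_pdivrMr//.
    have := Sle 1 n (oner_neq0 R); rewrite mulr1 => /le_trans; apply.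
    by rewrite [leRHS]mulrAC expr2.
  exact: (cvg_unique (@norm_hausdorff _ R^o) h1 h2).
have i0 t : t != 0 -> i t = 0.
  move=> t0.
  have hS := sin_second_order X2 (u0 t0 l01) (u_cvg t l01).
  have h0 : (fun _ : nat => i t) @ \oo --> (0 : R).
    (* With e = l^(2 n), the constant i t differs from sin(e i t) / e by O(e),
       and sin(e i t) / e is S / u^2 at u = l^n t, up to a bounded factor. *)
    pose b n := 2 * i t ^+ 2 * (l ^+ n * l ^+ n) + expR (r t) * t ^+ 2 *
       `|(S (l ^+ n * t) - l ^+ n * t * m) / (l ^+ n * t) ^+ 2|.
    apply: (@cvg0_of_norm_le _ _ b) => [n|].
      have ln : 0 < l ^+ n by rewrite exprn_gt0.
      have [e eE] : exists e, e = l ^+ n * l ^+ n by eexists.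
      have e0 : 0 < e by rewrite eE mulr_gt0.
      have e2 : (l ^+ n) ^+ 2 = e by rewrite eE expr2.
      have h1 : `|i t - sin (e * i t) / e| <= 2 * i t ^+ 2 * e.
        have -> : i t - sin (e * i t) / e = - ((sin (e * i t) - e * i t) / e).
          by field; rewrite gt_eqF.
        rewrite normrN normf_div (ger0_norm (ltW e0)) ler_pdivrMr//.
        apply: le_trans (normr_sin_sub_le _) _.
        by rewrite le_eqVlt; apply/orP; left; apply/eqP; ring.
      have h2 : `|sin (e * i t) / e| <= expR (r t) * t ^+ 2 *
          `|(S (l ^+ n * t) - l ^+ n * t * m) / (l ^+ n * t) ^+ 2|.
        rewrite m0 mulr0 subr0 Sr mulNr normrN.
        have [q qE] : exists q, q = t ^+ 2 by eexists.
        have q0 : 0 < q by rewrite qE exprn_even_gt0.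
        rewrite iln exprMn e2 -qE.
        rewrite !normf_div !normrM (ger0_norm (ltW e0)) (ger0_norm (ltW q0)).
        rewrite (@ger0_norm _ (expR _)) ?expR_ge0//.
        set s := `|sin _|.
        have -> : expR (r t) * q * (expR (- r (l ^+ n * t)) * s / (e * q)) =
            expR (r t - r (l ^+ n * t)) * (s / e).
          by rewrite expRD; field; rewrite !gt_eqF.
        have e1 : e <= 1.
          by rewrite -e2; apply: exprn_ile1; [exact: ltW|apply: exprn_ile1; exact: ltW].
        have : 1 <= expR (r t - r (l ^+ n * t)).
          rewrite -[leLHS]expR0 ler_expR subr_ge0 !rE ?u0// ler_pM2l// exprMn e2 -qE.
          by rewrite ler_piMl// ltW.
        by apply: ler_peMl; rewrite divr_ge0 ?normr_ge0// ltW.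
      rewrite -[i t](subrK (sin (e * i t) / e)).
      by apply: le_trans (ler_normD _ _) _; rewrite /b -eE lerD.
    rewrite [X in _ --> X](_ : _ =
        2 * i t ^+ 2 * (0 * 0) + expR (r t) * t ^+ 2 * `|0 : R|); last first.
      by rewrite normr0 !mulr0 addr0.
    apply: cvgD; apply: cvgM; try exact: cvg_cst.
      by apply: cvgM; exact: cvg_expr_lt1.
    exact: cvg_norm.
  exact: (cvg_unique (@norm_hausdorff _ R^o) (cvg_cst _) h0).
split=> // t; have [->|t0] := eqVneq t 0.
  rewrite /C /S; under eq_Rintegral do rewrite mul0r cos0.
  under [X in _ /\ X = _]eq_Rintegral do rewrite mul0r sin0.
  rewrite !Rintegral_cst// expr0n/= mulr0 oppr0 expR0 mul0r mul1r; split => //.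
  exact: (congr1 fine (probability_setT P)).
rewrite Cr Sr i0// sin0 cos0 mulr0 oppr0 mulr1; split => //.
by rewrite rE// /L m0 expr0n/= subr0.
Qed.

End finite_variance_rigidity.

(** A scaling factor above one is inverted, so that the iterates of the
    scaling always contract towards 0. *)
Lemma finite_variance_rigid d (Omega : measurableType d) (R : realType)
    (P : probability Omega R) (X : {RV P >-> R}) (r i : R -> R) (l c : R)
    (m := \int[P]_w X w) (v := \int[P]_w (X w ^+ 2)) :
  P.-integrable setT (EFin \o (fun w => X w ^+ 2)) ->
  0 < v - m ^+ 2 ->
  (forall t, \int[P]_w cos (t * X w) = expR (- r t) * cos (i t)) ->
  (forall t, \int[P]_w sin (t * X w) = - (expR (- r t) * sin (i t))) ->
  0 < l -> 0 < c ->
  (forall t, r (l * t) = c * r t) -> (forall t, i (l * t) = c * i t) ->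
  (l = 1 /\ c = 1) \/
  (m = 0 /\ forall t, \int[P]_w cos (t * X w) = expR (- (v / 2 * t ^+ 2)) /\
                      \int[P]_w sin (t * X w) = 0).
Proof.
move=> X2 vm Cr Sr l0 c0 rl il.
have l0' : l != 0 by rewrite gt_eqF.
have c0' : c != 0 by rewrite gt_eqF.
have [l1|l1|l1] := ltgtP l 1.
- by right; apply: (finite_variance_rigid_lt1 X2 vm Cr Sr rl il); rewrite l0.
- right; apply: (finite_variance_rigid_lt1 (l := l^-1) (c := c^-1) X2 vm Cr Sr).
  + by move=> t; rewrite -[in RHS](mulVKf l0' t) rl mulKf.
  + by move=> t; rewrite -[in RHS](mulVKf l0' t) il mulKf.
  + by rewrite invr_gt0 l0 invf_lt1.
- left; split => //; apply/eqP/negPn/negP => c1.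
  have r0 t : r t = 0.
    have := rl t; rewrite l1 mul1r => /eqP; rewrite -subr_eq0 -{1}[r t]mul1r -mulrBl.
    by rewrite mulf_eq0 subr_eq0 eq_sym (negbTE c1)/= => /eqP.
  (* Any null sequence shows that r is not identically 0. *)
  have half01 : 0 < (2^-1 : R) < 1 by rewrite invr_gt0 ltr0n invf_lt1// ltr1n.
  have h := @log_modulus_second_order _ _ _ P X X2 (fun n => 2^-1 ^+ n) _
     (cvg_expr_lt1 half01) r i Cr Sr.
  have h0 n : (2^-1 : R) ^+ n != 0 by rewrite expf_neq0.
  have {h} := h h0.
  under eq_fun do rewrite r0 mul0r.
  move=> h.
  have /eqP : 0 = (v - m ^+ 2) / 2.
    exact: (cvg_unique (@norm_hausdorff _ R^o) (cvg_cst _) h).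
  by rewrite eq_sym mulf_eq0 (gt_eqF vm)/= invr_eq0 pnatr_eq0.
Qed.

(** * Fourier transform of the normal density *)

Section gaussian_fourier.
Context {R : realType}.
Local Notation mu := (@lebesgue_measure R).

(** The intervals are centred at m because the Gaussian tail bound below is
    expressed in terms of the distance to the mean. *)
Lemma cvg_Rintegral_itv (m : R) (g : R -> R) :
  mu.-integrable setT (EFin \o g) ->
  \int[mu]_(x in `[m - n.+1%:R, m + n.+1%:R]) g x @[n --> \oo] --> \int[mu]_x g x.
Proof.
move=> ig; have mg : measurable_fun setT g by apply/measurable_EFinP; exact: measurable_int ig.
under eq_fun do rewrite Rintegral_mkcond.
have mi n : measurable_fun setT (g \_ `[m - n.+1%:R, m + n.+1%:R]).
  by apply/(measurable_restrictT _ _).1 => //; exact: measurable_funTS.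
have ptw x : (g \_ `[m - n.+1%:R, m + n.+1%:R]) x @[n --> \oo] --> g x.
  apply: cvg_near_cst; near=> n.
  rewrite patchE mem_set//= in_itv/=.
  have : `|x - m| <= n.+1%:R.
    rewrite (le_trans (ltW (truncnS_gt _)))// ler_nat ltnS.
    by near: n; exact: nbhs_infty_ge.
  by rewrite ler_norml; lra.
have bnd n x : `|(g \_ `[m - n.+1%:R, m + n.+1%:R]) x| <= `|g x|.
  by rewrite patchE; case: ifP; rewrite ?normr0.
by have [_] := @Rdominated_convergence _ _ R mu _ _ _ mi mg ptw (integrable_norm ig) bnd.
Unshelve. all: by end_near. Qed.

Lemma Rintegral_derivative_eq0 (m : R) (F g : R -> R) :
  continuous g -> (forall x : R, is_derive x (1 : R) F (g x)) ->
  mu.-integrable setT (EFin \o g) ->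
  F (m + n.+1%:R) @[n --> \oo] --> 0 -> F (m - n.+1%:R) @[n --> \oo] --> 0 ->
  \int[mu]_x g x = 0.
Proof.
move=> cg dF ig F1 F2.
have cF : continuous F.
  by move=> x; apply: differentiable_continuous; apply/derivable1_diffP; apply: ex_derive.
have := cvg_Rintegral_itv m ig.
have E n : \int[mu]_(x in `[m - n.+1%:R, m + n.+1%:R]) g x = F (m + n.+1%:R) - F (m - n.+1%:R).
  rewrite /Rintegral (@continuous_FTC2 _ g F) ?fineB//.
  - by rewrite ltrD2l; apply: lt_trans (_ : 0 < _); rewrite ?oppr_lt0.
  - exact: continuous_subspaceT.
  - split=> [x _||]; first exact: ex_derive.
    + by apply: cvg_at_right_filter; exact: cF.
    + by apply: cvg_at_left_filter; exact: cF.
  - by move=> x _; rewrite derive1E derive_val.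
under eq_fun do rewrite E.
move=> h; have h0 : F (m + n.+1%:R) - F (m - n.+1%:R) @[n --> \oo] --> (0 : R).
  by rewrite -[X in _ --> X](subrr 0); exact: cvgB.
exact: (cvg_unique (@norm_hausdorff _ R^o) h h0).
Qed.

Variables (m s : R).
Hypothesis s0 : s != 0.

Let n := normal_pdf m s.

Lemma normal_pdf_def x : n x = normal_peak s * expR (- (x - m) ^+ 2 / (s ^+ 2 *+ 2)).
Proof. by rewrite /n normal_pdfE. Qed.

Lemma is_derive_normal_pdf (x : R) : is_derive x (1 : R) n (- ((x - m) / s ^+ 2) * n x).
Proof.
have -> : n = (fun x => normal_peak s * expR (- (x - m) ^+ 2 / (s ^+ 2 *+ 2))).
  by apply/funext => y; exact: normal_pdf_def.
apply: is_derive_eq.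
rewrite /GRing.scale/=.
by field; rewrite s0.
Qed.

Lemma normal_pdf_tail y : y != 0 -> n (m + y) <= normal_peak s * (2 * s ^+ 2) / y ^+ 2.
Proof.
move=> y0; rewrite normal_pdf_def -mulrA ler_wpM2l ?normal_peak_ge0//.
have s2 : 0 < s ^+ 2 by rewrite exprn_even_gt0.
have y2 : 0 < y ^+ 2 by rewrite exprn_even_gt0.
have z0 : 0 < y ^+ 2 / (s ^+ 2 *+ 2) by rewrite divr_gt0// mulrn_wgt0.
have -> : 2 * s ^+ 2 / y ^+ 2 = (y ^+ 2 / (s ^+ 2 *+ 2))^-1.
  by field; rewrite s0 y0.
rewrite addrAC subrr add0r mulNr expRN lef_pV2 ?posrE ?expR_gt0//.
by apply: le_trans (expR_ge1Dx _); rewrite lerDr.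
Qed.

(** Multiplying by |x - m| costs no more than doubling the standard
    deviation, so the derivative of the integrand is dominated by a multiple
    of another normal density. *)
Lemma normal_pdf_first_moment_ub :
  exists C, forall x, `|x - m| * n x <= C * normal_pdf m (2 * s) x.
Proof.
have s20 : 2 * s != 0 by rewrite mulf_neq0.
have p0 := normal_peak_gt0 s20.
exists (`|s| * normal_peak s / normal_peak (2 * s)) => x.
rewrite normal_pdf_def (normal_pdfE _ s20) /normal_fun.
set z := (x - m) / s.
have -> : x - m = s * z by rewrite /z; field.
rewrite normrM; set p := normal_peak (2 * s) in p0 *.
have -> : `|s| * normal_peak s / p * (p * expR (- (s * z) ^+ 2 / ((2 * s) ^+ 2 *+ 2))) =
  `|s| * normal_peak s * expR (- (s * z) ^+ 2 / ((2 * s) ^+ 2 *+ 2)).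
  by field; rewrite gt_eqF.
have key : `|z| * expR (- (s * z) ^+ 2 / (s ^+ 2 *+ 2)) <=
    expR (- (s * z) ^+ 2 / ((2 * s) ^+ 2 *+ 2)).
  have -> : - (s * z) ^+ 2 / ((2 * s) ^+ 2 *+ 2) =
      z ^+ 2 * (3 / 8) + - (s * z) ^+ 2 / (s ^+ 2 *+ 2) by field.
  rewrite expRD ler_wpM2r ?expR_ge0//.
  apply: le_trans (expR_ge1Dx _).
  by rewrite -(real_normK (num_real z)); have := sqr_ge0 (`|z| - 2); have := sqr_ge0 `|z|; nra.
have := ler_wpM2l (mulr_ge0 (normr_ge0 s) (normal_peak_ge0 s)) key.
by apply: le_trans; rewrite le_eqVlt; apply/orP; left; apply/eqP; ring.
Qed.

Variables (f g : R -> R).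
Hypothesis df : forall x : R, is_derive x (1 : R) f (g x).
Hypothesis dg : forall x : R, is_derive x (1 : R) g (- f x).
Hypothesis fle1 : forall x, `|f x| <= 1.
Hypothesis gle1 : forall x, `|g x| <= 1.

Let cf : continuous f.
Proof.
by move=> x; apply: differentiable_continuous; apply/derivable1_diffP; apply: ex_derive.
Qed.

Let cg : continuous g.
Proof.
by move=> x; apply: differentiable_continuous; apply/derivable1_diffP; apply: ex_derive.
Qed.

Let phi t := \int[mu]_x (f (t * (x - m)) * n x).

Let measurable_comp_lin (h : R -> R) t : continuous h ->
  measurable_fun setT (fun x : R => h (t * (x - m))).
Proof.
move=> ch; apply: continuous_measurable_fun => x; apply: continuous_comp; last exact: ch.
by apply: cvgM; [exact: cvg_cst|apply: cvgB; [exact: cvg_id|exact: cvg_cst]].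
Qed.

Let integrable_mul_pdf (h : R -> R) t : continuous h -> (forall x, `|h x| <= 1) ->
  mu.-integrable setT (EFin \o (fun x => h (t * (x - m)) * n x)).
Proof.
move=> ch h1; apply: le_integrable (integrable_normal_pdf m s) => //.
  apply/measurable_EFinP; apply: measurable_funM; first exact: measurable_comp_lin.
  exact: measurable_normal_pdf.
move=> x _; rewrite /= lee_fin normrM; exact: ler_piMl.
Qed.

Let integrable_mul_moment (h : R -> R) t : continuous h -> (forall x, `|h x| <= 1) ->
  mu.-integrable setT (EFin \o (fun x => h (t * (x - m)) * ((x - m) * n x))).
Proof.
move=> ch h1; have [C HC] := normal_pdf_first_moment_ub.
have iC : mu.-integrable setT (EFin \o (fun x => C * normal_pdf m (2 * s) x)).
  by apply: (integrableZl measurableT C (integrable_normal_pdf m (2 * s))).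
apply: le_integrable iC => //.
  apply/measurable_EFinP; apply: measurable_funM; first exact: measurable_comp_lin.
  apply: measurable_funM; first by apply: measurable_funB => //; exact: measurable_id.
  exact: measurable_normal_pdf.
move=> x _; rewrite /= lee_fin.
apply: (@le_trans _ _ (C * normal_pdf m (2 * s) x)); last exact: ler_norm.
apply: le_trans (HC x); rewrite normrM normrM (ger0_norm (normal_pdf_ge0 m s x)).
by apply: ler_piMl => //; rewrite mulr_ge0// normal_pdf_ge0.
Qed.

(** Gaussian integration by parts: the primitive g(t (x - m)) n(x) vanishes
    at both ends. *)
Lemma gaussian_by_parts t :
  \int[mu]_x (g (t * (x - m)) * ((x - m) * n x)) = - (s ^+ 2 * t) * phi t.
Proof.
pose F x := g (t * (x - m)) * n x.
pose F' x := - t * (f (t * (x - m)) * n x) - (s ^+ 2)^-1 * (g (t * (x - m)) * ((x - m) * n x)).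
have cn : continuous n by exact: continuous_normal_pdf.
have clin : continuous (fun x : R => t * (x - m)).
  by move=> x; apply: cvgM; [exact: cvg_cst|apply: cvgB; [exact: cvg_id|exact: cvg_cst]].
have cflin : continuous (fun x : R => f (t * (x - m))).
  by move=> x; apply: continuous_comp; [exact: clin|exact: cf].
have cglin : continuous (fun x : R => g (t * (x - m))).
  by move=> x; apply: continuous_comp; [exact: clin|exact: cg].
have dF x : is_derive x (1 : R) F (F' x).
  have dl : is_derive x (1 : R) (fun x : R => t * (x - m)) t.
    by apply: is_derive_eq; rewrite /GRing.scale/= subr0 mulr1.
  have dgl : is_derive x (1 : R) (fun x : R => g (t * (x - m))) (- f (t * (x - m)) * t).
    exact: (@is_derive1_comp R g (fun x : R => t * (x - m)) x _ _ (dg _) dl).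
  have dn := is_derive_normal_pdf x.
  apply: (is_derive_eq (is_deriveM dgl dn)).
  rewrite /GRing.scale/= /F'; field.
  exact: s0.
have F0 y : y != 0 -> `|F (m + y)| <= normal_peak s * (2 * s ^+ 2) / y ^+ 2.
  move=> y0; apply: le_trans (normal_pdf_tail y0).
  rewrite /F normrM (ger0_norm (normal_pdf_ge0 m s _)).
  by apply: ler_piMl => //; exact: normal_pdf_ge0.
have lim0 : (normal_peak s * (2 * s ^+ 2)) * k.+1%:R^-1 @[k --> \oo] --> (0 : R).
  rewrite -[X in _ --> X](mulr0 (normal_peak s * (2 * s ^+ 2))).
  by apply: cvgM; [exact: cvg_cst|exact: cvg_harmonic].
have bnd k : normal_peak s * (2 * s ^+ 2) / k.+1%:R ^+ 2 <=
    (normal_peak s * (2 * s ^+ 2)) * k.+1%:R^-1.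
  apply: ler_wpM2l; first by rewrite mulr_ge0 ?normal_peak_ge0// mulr_ge0// sqr_ge0.
  by rewrite lef_pV2 ?posrE ?exprn_gt0// expr2 ler_peMr// ler1n.
have i1 := integrable_mul_pdf t cf fle1.
have i2 := integrable_mul_moment t cg gle1.
have i1' := integrableZl measurableT (- t) i1.
have i2' := integrableZl measurableT (s ^+ 2)^-1 i2.
have iF' : mu.-integrable setT (EFin \o F').
  exact: (integrableB measurableT i1' i2').
have cF' : continuous F'.
  move=> x; apply: cvgB; apply: cvgM; try exact: cvg_cst.
    by apply: cvgM; [exact: cflin|exact: cn].
  apply: cvgM; first exact: cglin.
  by apply: cvgM; [apply: cvgB; [exact: cvg_id|exact: cvg_cst]|exact: cn].
have := @Rintegral_derivative_eq0 m F F' cF' dF iF'.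
have lim1 : F (m + k.+1%:R) @[k --> \oo] --> 0.
  by apply: cvg0_of_norm_le lim0 => k; apply: le_trans (bnd k); exact: F0.
have lim2 : F (m - k.+1%:R) @[k --> \oo] --> 0.
  apply: cvg0_of_norm_le lim0 => k; apply: le_trans (bnd k).
  by have := F0 (- k.+1%:R); rewrite sqrrN; apply; rewrite oppr_eq0.
move=> /(_ lim1 lim2).
rewrite RintegralB// !RintegralZl// -/(phi t) => h.
set J := \int[mu]_x _ in h *.
have -> : J = s ^+ 2 * ((s ^+ 2)^-1 * J) by field.
have -> : (s ^+ 2)^-1 * J = - t * phi t by lra.
by ring.
Qed.

(** Differentiation under the integral sign brings down a factor
    (x - m), which integration by parts turns back into the transform itself. *)
Lemma gaussian_fourier_ode t : is_derive t (1 : R) phi (- (s ^+ 2 * t) * phi t).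
Proof.
pose h t x := f (t * (x - m)) * n x.
have dh u x : is_derive u (1 : R) (h ^~ x) (g (u * (x - m)) * ((x - m) * n x)).
  have dl : is_derive u (1 : R) (fun u : R => u * (x - m)) (x - m).
    by apply: is_derive_eq; rewrite /GRing.scale/= ; ring.
  have dfl : is_derive u (1 : R) (fun u : R => f (u * (x - m))) (g (u * (x - m)) * (x - m)).
    exact: (@is_derive1_comp R f (fun u : R => u * (x - m)) u _ _ (df _) dl).
  apply: (is_derive_eq (is_deriveM dfl (is_derive_cst (n x) u (1 : R)))).
  by rewrite /GRing.scale/=; ring.
have [C HC] := normal_pdf_first_moment_ub.
have iC : mu.-integrable setT (EFin \o (fun x => C * normal_pdf m (2 * s) x)).
  by apply: (integrableZl measurableT C (integrable_normal_pdf m (2 * s))).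
have tI : `]t - 1, t + 1[%classic t by rewrite /= in_itv/=; lra.
have hder u x : `]t - 1, t + 1[%classic u -> setT x -> derivable (h ^~ x) u 1.
  by move=> _ _; exact: ex_derive.
have hint u : `]t - 1, t + 1[%classic u -> mu.-integrable setT (EFin \o h u).
  by move=> _; exact: integrable_mul_pdf.
have C0 x : 0 <= C * normal_pdf m (2 * s) x.
  by apply: le_trans (HC x); rewrite mulr_ge0// normal_pdf_ge0.
have dhE u x : partial1of2 h u x = g (u * (x - m)) * ((x - m) * n x).
  by rewrite partial1of2E derive_val.
have hub u x : `]t - 1, t + 1[%classic u -> setT x ->
    `|partial1of2 h u x| <= C * normal_pdf m (2 * s) x.
  move=> _ _; rewrite dhE.
  apply: le_trans (HC x); rewrite normrM normrM (ger0_norm (normal_pdf_ge0 m s x)).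
  by apply: ler_piMl => //; rewrite mulr_ge0// normal_pdf_ge0.
have d1 := derivable_under_integral measurableT tI hint hder C0 iC hub.
have d2 := differentiation_under_integral measurableT tI hint hder C0 iC hub.
apply: DeriveDef; first exact: d1.
rewrite -derive1E [LHS]d2 -gaussian_by_parts; apply: eq_Rintegral => x _; exact: dhE.
Qed.

(** The cosine and the sine transforms satisfy the same equation
    phi' = - s^2 t phi and only differ by the value f 0; hence the abstract pair
    (f, g) with f' = g and g' = - f. *)
Lemma gaussian_fourier_trig t : phi t = f 0 * expR (- (s ^+ 2 * t ^+ 2 / 2)).
Proof.
pose h t := phi t * expR (s ^+ 2 * t ^+ 2 / 2).
have dh u : is_derive u (1 : R) h 0.
  have du : is_derive u (1 : R) (fun u => s ^+ 2 * u ^+ 2 / 2) (s ^+ 2 * u).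
    by apply: is_derive_eq; rewrite /GRing.scale/=; field.
  have de : is_derive u (1 : R) (fun u => expR (s ^+ 2 * u ^+ 2 / 2))
      (expR (s ^+ 2 * u ^+ 2 / 2) * (s ^+ 2 * u)).
    exact: (@is_derive1_comp R expR (fun u : R => s ^+ 2 * u ^+ 2 / 2) u _ _
      (is_derive_expR _) du).
  apply: (is_derive_eq (is_deriveM (gaussian_fourier_ode u) de)).
  by rewrite /GRing.scale/=; ring.
have : h t = f 0.
  rewrite (is_derive_0_is_cst t 0 dh) /h /phi expr0n/= mulr0 mul0r expR0 mulr1.
  under eq_Rintegral do rewrite mul0r.
  rewrite RintegralZl//; last exact: integrable_normal_pdf.
  by rewrite /Rintegral integral_normal_pdf mulr1.
by rewrite /h => <-; rewrite -[RHS]mulrA -expRD subrr expR0 mulr1.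
Qed.

End gaussian_fourier.

(** * Concentration of narrow normal laws *)

Section normal_concentration.
Context {R : realType}.
Local Notation mu := (@lebesgue_measure R).

Lemma normal_peak_double (s : R) : normal_peak s = 2 * normal_peak (2 * s).
Proof.
rewrite /normal_peak.
have -> : (2 * s) ^+ 2 * pi *+ 2 = 2 ^+ 2 * (s ^+ 2 * pi *+ 2) by ring.
by rewrite sqrtrM ?sqr_ge0// sqrtr_sqr ger0_norm// invfM mulrA divff// mul1r.
Qed.

(** At distance d from the mean, the density is smaller than the one with
    twice the standard deviation by a factor 2 exp(- 3 z / 8), z >= (d / s)^2;
    the rational bound 1 / z replaces the exponential. *)
Lemma normal_pdf_far (x s y d : R) : s != 0 -> 0 < d -> d <= `|y - x| ->
  normal_pdf x s y <= 6 * (s / d) ^+ 2 * normal_pdf x (2 * s) y.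
Proof.
move=> s0 d0 dy; have s20 : 2 * s != 0 by rewrite mulf_neq0.
rewrite !normal_pdfE// /normal_fun normal_peak_double.
set p := normal_peak (2 * s).
have p0 : 0 <= p by exact: normal_peak_ge0.
set z := (y - x) ^+ 2 / s ^+ 2.
have dz : (d / s) ^+ 2 <= z.
  rewrite /z expr_div_n ler_wpM2r ?invr_ge0 ?sqr_ge0//.
  by rewrite -(real_normK (num_real (y - x))) ler_sqr ?nnegrE// ltW.
have ds0 : 0 < (d / s) ^+ 2 by rewrite exprn_even_gt0//= mulf_neq0 ?invr_eq0// gt_eqF.
have -> : - (y - x) ^+ 2 / (s ^+ 2 *+ 2) = - (z * (3 / 8)) + - (y - x) ^+ 2 / ((2 * s) ^+ 2 *+ 2).
  by rewrite /z; field.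
rewrite expRD.
have h : 2 * expR (- (z * (3 / 8))) <= 6 * (s / d) ^+ 2.
  rewrite expRN.
  have z1 : 0 < z by exact: lt_le_trans dz.
  have h1 : (expR (z * (3 / 8)))^-1 <= (z * (3 / 8))^-1.
    have z38 : 0 < z * (3 / 8) by lra.
    rewrite lef_pV2 ?posrE ?expR_gt0//.
    by apply: le_trans (expR_ge1Dx _); rewrite lerDr.
  have h2 : z^-1 <= (s / d) ^+ 2.
    by rewrite -[s / d]invf_div exprVn lef_pV2 ?posrE.
  have h3 : (z * (3 / 8))^-1 = z^-1 * (8 / 3) by field; rewrite gt_eqF.
  have z2 : 0 < z^-1 by rewrite invr_gt0.
  by move: h1; rewrite h3; lra.
have := ler_wpM2r (mulr_ge0 p0 (expR_ge0 (- (y - x) ^+ 2 / ((2 * s) ^+ 2 *+ 2)))) h.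
by apply: le_trans; rewrite le_eqVlt; apply/orP; left; apply/eqP; ring.
Qed.

Lemma normal_prob_far (x s d : R) (A : set (measurableTypeR R)) : s != 0 -> 0 < d ->
  measurable A -> (forall y, A y -> d <= `|y - x|) ->
  (normal_prob x s A <= (6 * (s / d) ^+ 2)%:E)%E.
Proof.
move=> s0 d0 mA Ad; rewrite /normal_prob.
have K0 : 0 <= 6 * (s / d) ^+ 2 by apply: mulr_ge0; rewrite ?sqr_ge0.
have m1 q : measurable_fun (setT : set (measurableTypeR R)) (fun y => (normal_pdf x q y)%:E).
  by apply/measurable_EFinP; exact: measurable_normal_pdf.
apply: (@le_trans _ _
  (\int[mu]_(y in A) ((6 * (s / d) ^+ 2)%:E * (normal_pdf x (2 * s) y)%:E))%E).
  apply: ge0_le_integral => //.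
  - by move=> y _; rewrite lee_fin normal_pdf_ge0.
  - exact: measurable_funTS.
  - by apply: measurable_funTS; apply: emeasurable_funM => //; exact: measurable_cst.
  - by move=> y Ay; rewrite -EFinM lee_fin normal_pdf_far// Ad.
rewrite ge0_integralZl_EFin//; last 2 first.
- by move=> y _; rewrite lee_fin normal_pdf_ge0.
- exact: measurable_funTS.
rewrite -[leRHS]mule1; apply: lee_wpmul2l => //.
rewrite -(integral_normal_pdf x (2 * s)); apply: ge0_subset_integral => //.
by move=> y _; rewrite lee_fin normal_pdf_ge0.
Qed.

(** The normal law of mean x concentrates at x.  The end point moves to
    c - r_n while the width r_n^2 is of smaller order, so that the boundary
    case x = c gives 0 in the limit, instead of 1 / 2. *)
Lemma cvg_normal_prob_ray (x c : R) (rr := fun n : nat => n.+1%:R^-1 : R) :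
  fine (normal_prob x (rr n ^+ 2) `]-oo, c - rr n]) @[n --> \oo] --> ((x < c)%R%:R : R).
Proof.
have r0 n : 0 < rr n by rewrite invr_gt0.
have rc : rr n @[n --> \oo] --> 0 by exact: cvg_harmonic.
have s0 n : rr n ^+ 2 != 0 by rewrite expf_neq0// gt_eqF.
have lim0 : 6 * (rr n ^+ 2 / (c - x - rr n)) ^+ 2 @[n --> \oo] --> 0.
  suff h : rr n ^+ 2 / (c - x - rr n) @[n --> \oo] --> 0.
    rewrite [X in _ --> X](_ : _ = 6 * (0 * 0)); last by rewrite !mulr0.
    by apply: cvgM; [exact: cvg_cst|exact: cvgM].
  have [cx|cx] := eqVneq c x.
    have -> : (fun n => rr n ^+ 2 / (c - x - rr n)) = (fun n => - rr n).
      by apply/funext => n; rewrite cx; field; rewrite subrr sub0r oppr_eq0 gt_eqF.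
    by rewrite -[X in _ --> X]oppr0; exact: cvgN.
  rewrite [X in _ --> X](_ : _ = 0 * 0 / (c - x - 0)); last by rewrite !mul0r.
  apply: cvgM; first exact: cvgM.
  apply: cvgV; first by rewrite subr0 subr_eq0.
  by apply: cvgB => //; exact: cvg_cst.
have pfin n B : measurable B -> normal_prob x (rr n ^+ 2) B \is a fin_num.
  by move=> mB; exact: fin_num_measure.
have [xc|cx] := ltP x c; apply/subr_cvg0; apply: cvg0_of_near_norm_le lim0.
  have cx0 : 0 < c - x by lra.
  apply: filterS (cvgr_lt 0 rc (c - x) cx0) => n; rewrite -subr_gt0 => d0.
  have mI : measurable (`]-oo, (c - rr n)%R] : set (measurableTypeR R)) by [].
  have hC : normal_prob x (rr n ^+ 2) (~` `]-oo, c - rr n]) =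
      (1 - normal_prob x (rr n ^+ 2) `]-oo, (c - rr n)%R])%E.
    exact: (probability_setC (normal_prob x (rr n ^+ 2)) mI).
  have -> : fine (normal_prob x (rr n ^+ 2) `]-oo, c - rr n]) - true%:R =
     - fine (normal_prob x (rr n ^+ 2) (~` `]-oo, c - rr n])).
    rewrite hC.
    by case: (normal_prob _ _ _) (pfin n _ mI) => [p| |] // _; rewrite -EFinB /= opprB.
  rewrite normrN ger0_norm ?fine_ge0// -lee_fin fineK; last exact/pfin/measurableC.
  apply: normal_prob_far => //; first exact: measurableC.
  move=> y; rewrite /= in_itv/= => /negP; rewrite -ltNge => h.
  by rewrite ger0_norm; lra.
apply: nearW => n.
rewrite subr0 ger0_norm ?fine_ge0// -lee_fin fineK; last exact: pfin.
have -> : (rr n ^+ 2 / (c - x - rr n)) ^+ 2 = (rr n ^+ 2 / (rr n + x - c)) ^+ 2.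
  by rewrite -sqrrN -mulrN -invrN; congr ((_ / _) ^+ 2); ring.
apply: normal_prob_far => //; first by have := r0 n; lra.
move=> y; rewrite /= in_itv/= => h.
by rewrite distrC ger0_norm; have := r0 n; lra.
Qed.

End normal_concentration.

(** * Uniqueness of characteristic functions *)

Lemma gaussian_fourier_cos (R : realType) (s : R) (u : R) : s != 0 ->
  \int[@lebesgue_measure R]_x (cos (u * x) * normal_pdf 0 s x) =
  expR (- (u ^+ 2 * s ^+ 2 / 2)).
Proof.
move=> s0; have := @gaussian_fourier_trig R 0 s s0 cos (fun x => - sin x).
have dN x : is_derive x (1 : R) (fun x : R => - sin x) (- cos x).
  by apply: is_derive_eq.
move=> /(_ (@is_derive_cos R) dN (@cos_max R)).
have N1 (x : R) : `|- sin x| <= 1 by rewrite normrN sin_max.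
move=> /(_ N1 u); rewrite cos0 mul1r (mulrC (s ^+ 2)) => <-.
by apply: eq_Rintegral => x _; rewrite subr0.
Qed.

Section smoothing.
Context d (Omega : measurableType d) (R : realType) (P : probability Omega R).
Variable X : {RV P >-> R}.
Local Notation mu := (@lebesgue_measure R).

(** Parseval: the Gaussian bump is the cosine transform of a normal density
    of standard deviation 1 / s, and Fubini exchanges the two integrals.  The
    right-hand side depends on X through its characteristic function only. *)
Lemma expectation_normal_fun (y s : R) : s != 0 ->
  (\int[P]_w (normal_fun y s (X w))%:E =
   \int[mu]_t (((\int[P]_w cos (t * X w)) * cos (t * y) +
                (\int[P]_w sin (t * X w)) * sin (t * y)) *
               normal_pdf 0 s^-1 t)%:E)%E.
Proof.
move=> s0; have s1 : s^-1 != 0 by rewrite invr_eq0.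
pose n := normal_pdf 0 s^-1 : R -> R.
have n0 t : 0 <= n t by exact: normal_pdf_ge0.
have mn : measurable_fun setT n by exact: measurable_normal_pdf.
have in1 : mu.-integrable setT (EFin \o n) by exact: integrable_normal_pdf.
pose F (z : Omega * measurableTypeR R) := (cos ((X z.1 - y) * z.2) * n z.2)%:E.
have mF : measurable_fun setT F.
  apply/measurable_EFinP/measurable_funM; last first.
    by apply: measurableT_comp => //; exact: measurable_snd.
  apply: (measurableT_comp (continuous_measurable_fun (@continuous_cos R))).
  apply: measurable_funM; last exact: measurable_snd.
  by apply: measurable_funB => //; apply: measurableT_comp => //; exact: measurable_fst.
have iF : (P \x mu)%E.-integrable setT F.
  apply/integrable12ltyP => //.
  apply: (@le_lt_trans _ _ (\int[P]_w 1)%E); last first.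
    by rewrite integral_cst// mul1e -ge0_fin_numE// fin_num_measure.
  apply: ge0_le_integral => //.
  - by move=> w _; exact: integral_ge0.
  - apply: (measurable_fun_fubini_tonelli_F (abse \o F)).
      exact: measurableT_comp.
    by move=> z; exact: abse_ge0.
  - move=> w _; rewrite -(integral_normal_pdf 0 s^-1).
    apply: ge0_le_integral => //.
    + apply: measurableT_comp => //.
      exact: (measurableT_comp mF (measurable_pair1 w)).
    + exact/measurable_EFinP.
    + move=> t _; rewrite /F/= lee_fin normrM (ger0_norm (n0 t)).
      by apply: ler_piMl => //; exact: cos_max.
transitivity (\int[P]_w \int[mu]_t F (w, t))%E.
  apply: eq_integral => w _.
  have /esym := gaussian_fourier_cos (X w - y) s1.
  rewrite exprVn.
  have -> : expR (- ((X w - y) ^+ 2 / s ^+ 2 / 2)) = normal_fun y s (X w).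
    by rewrite /normal_fun; congr expR; field.
  move=> ->; rewrite /Rintegral fineK; last first.
    apply: integrable_fin_num => //; apply: (le_integrable _ _ _ in1) => //.
      exact: (measurableT_comp mF (measurable_pair1 w)).
    move=> t _; rewrite /F/= lee_fin normrM.
    by apply: ler_piMl => //; exact: cos_max.
  by [].
rewrite (Fubini iF); apply: eq_integral => t _.
have iC := integrable_cos X t; have iS := integrable_sin X t.
have iCS : P.-integrable setT
    (EFin \o (fun w => cos (t * X w) * cos (t * y) + sin (t * X w) * sin (t * y))).
  exact: (integrableD measurableT (integrableZr measurableT _ iC)
    (integrableZr measurableT _ iS)).
transitivity ((\int[P]_w (cos (t * X w) * cos (t * y) + sin (t * X w) * sin (t * y)))%:E *
    (n t)%:E)%E.
  rewrite /Rintegral fineK; last first.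
    exact: (integrable_fin_num measurableT iCS).
  rewrite -integralZr//.
  apply: eq_integral => w _; rewrite /F/= -EFinM; congr (_ * _)%:E.
  by rewrite mulrC mulrBr cosB.
rewrite -EFinM; congr (_ * _)%:E.
rewrite RintegralD//; first last.
- exact: (integrableZr measurableT _ iS).
- exact: (integrableZr measurableT _ iC).
by rewrite !RintegralZr.
Qed.

End smoothing.

Section tonelli.
Context d (Omega : measurableType d) (R : realType) (P : probability Omega R).
Variable X : {RV P >-> R}.
Local Notation mu := (@lebesgue_measure R).

Lemma normal_pdf_sym (x y s : R) : s != 0 ->
  normal_pdf x s y = normal_peak s * normal_fun y s x.
Proof.
move=> s0; rewrite normal_pdfE// /normal_fun; congr (_ * expR _).
by rewrite -sqrrN opprB.
Qed.

Section ray.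
Variables (c s : R).
Hypothesis s0 : s != 0.

Let F (z : Omega * measurableTypeR R) :=
  (normal_peak s * normal_fun z.2 s (X z.1) * \1_(`]-oo, c] : set R) z.2)%:E.

Let F0 z : (0 <= F z)%E.
Proof. by rewrite lee_fin mulr_ge0// mulr_ge0 ?normal_peak_ge0 ?normal_fun_ge0. Qed.

Let mF : measurable_fun setT F.
Proof.
apply/measurable_EFinP/measurable_funM; last first.
  apply: measurableT_comp; last exact: measurable_snd.
  exact: measurable_indic.
apply: measurable_funM => //; rewrite /normal_fun.
apply: (measurableT_comp (@measurable_expR R)).
apply: measurable_funM => //; apply: measurableT_comp => //.
apply: measurable_funX; apply: measurable_funB; last exact: measurable_snd.
by apply: measurableT_comp => //; exact: measurable_fst.
Qed.

Let normal_prob_rayE w : normal_prob (X w) s `]-oo, c] = (\int[mu]_y F (w, y))%E.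
Proof.
rewrite /normal_prob integral_mkcond.
apply: eq_integral => y _; rewrite patchE /F/= indicE normal_pdf_sym//.
by case: ifPn; rewrite ?mulr1 ?mulr0.
Qed.

Lemma measurable_normal_prob_ray :
  measurable_fun setT (fun w => normal_prob (X w) s `]-oo, c]).
Proof.
under eq_fun do rewrite normal_prob_rayE.
exact: (measurable_fun_fubini_tonelli_F F mF F0).
Qed.

(** By symmetry of the Gaussian kernel in (X w, y), Tonelli reduces the
    smoothed distribution function of X to the averages of
    [expectation_normal_fun]. *)
Lemma expectation_normal_ray :
  (\int[P]_w normal_prob (X w) s `]-oo, c] =
   \int[mu]_(y in `]-oo, c]) ((normal_peak s)%:E * \int[P]_w (normal_fun y s (X w))%:E))%E.
Proof.
under eq_integral do rewrite normal_prob_rayE.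
rewrite (fubini_tonelli F)// [RHS]integral_mkcond; apply: eq_integral => y _.
rewrite patchE; case: ifPn => yc.
  rewrite -ge0_integralZl_EFin ?normal_peak_ge0//.
  - by apply: eq_integral => w _; rewrite /F/= indicE yc mulr1 EFinM.
  - by move=> w _; rewrite lee_fin normal_fun_ge0.
  - apply/measurable_EFinP; apply: measurableT_comp => //.
    exact: measurable_normal_fun.
by apply: integral0_eq => w _; rewrite /F/= indicE (negbTE yc) mulr0.
Qed.

End ray.

Lemma cvg_expectation_normal_ray (c : R) (rr := fun n : nat => n.+1%:R^-1 : R) :
  (\int[P]_w normal_prob (X w) (rr n ^+ 2)%R `]-oo, (c - rr n)%R])%E @[n --> \oo] -->
  distribution P X `]-oo, c[.
Proof.
have s0 n : rr n ^+ 2 != 0 by rewrite expf_neq0// invr_eq0 pnatr_eq0.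
pose f w := ((X w < c)%R%:R : R)%:E.
have fE : f = (fun w => (\1_(X @^-1` `]-oo, c[) w)%:E).
  apply/funext => w; rewrite /f indicE.
  suff -> : (w \in X @^-1` `]-oo, c[) = (X w < c) by [].
  by apply/idP/idP; rewrite inE/= in_itv.
have mI : measurable (X @^-1` `]-oo, c[).
  by rewrite -[X @^-1` _]setTI; exact: measurable_funPT.
have -> : distribution P X `]-oo, c[ = (\int[P]_w f w)%E.
  by rewrite fE integral_indic// setIT.
have m1 n : measurable_fun setT (fun w => normal_prob (X w) (rr n ^+ 2)%R `]-oo, c - rr n]).
  exact: measurable_normal_prob_ray.
have mf : measurable_fun setT f.
  by rewrite fE; apply/measurable_EFinP; exact: measurable_indic.
have ptw w : setT w -> normal_prob (X w) (rr n ^+ 2)%R `]-oo, c - rr n] @[n --> \oo] --> f w.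
  move=> _; apply: cvg_EFin; last exact: cvg_normal_prob_ray.
  by apply: nearW => n; exact: fin_num_measure.
have bnd w n : setT w -> (`|normal_prob (X w) (rr n ^+ 2)%R `]-oo, (c - rr n)%R]| <= 1)%E.
  by move=> _; rewrite gee0_abs//; exact: probability_le1.
have i1 : P.-integrable setT (cst 1%E : Omega -> \bar R) by exact: finite_measure_integrable_cst.
by have [] := @dominated_convergence _ _ _ P _ measurableT _ _ _ m1 mf (aeW _ ptw) i1 (aeW _ bnd).
Qed.

End tonelli.

(** Uniqueness of characteristic functions: the smoothed distribution functions
    of X and Y agree, hence so do their limits P(X < c) and Q(Y < c), and open
    rays form a pi-system generating the Borel sets. *)
Lemma distribution_eq_of_char d (Omega : measurableType d) d' (Omega' : measurableType d')
  (R : realType) (P : probability Omega R) (Q : probability Omega' R)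
  (X : {RV P >-> R}) (Y : {RV Q >-> R}) :
  (forall t, \int[P]_w cos (t * X w) = \int[Q]_w cos (t * Y w)) ->
  (forall t, \int[P]_w sin (t * X w) = \int[Q]_w sin (t * Y w)) ->
  forall A : set R, measurable A -> distribution P X A = distribution Q Y A.
Proof.
move=> hc hs.
have ray c : distribution P X `]-oo, c[ = distribution Q Y `]-oo, c[.
  pose smooth d (T : measurableType d) (M : probability T R) (Z : {RV M >-> R}) (n : nat) :=
    (\int[M]_w normal_prob (Z w) (n.+1%:R^-1 ^+ 2)%R `]-oo, (c - n.+1%:R^-1)%R])%E.
  have XY : smooth _ _ P X = smooth _ _ Q Y.
    apply/funext => n; rewrite /smooth.
    have s0 : (n.+1%:R^-1 : R) ^+ 2 != 0 by rewrite expf_neq0// invr_eq0 pnatr_eq0.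
    rewrite !expectation_normal_ray//; apply: eq_integral => y _; congr (_ * _)%E.
    rewrite !expectation_normal_fun//; apply: eq_integral => t _.
    by rewrite hc hs.
  have hX : smooth _ _ P X @ \oo --> distribution P X `]-oo, c[.
    exact: cvg_expectation_normal_ray.
  have hY : smooth _ _ P X @ \oo --> distribution Q Y `]-oo, c[.
    by rewrite XY; exact: cvg_expectation_normal_ray.
  exact: (cvg_unique _ hX hY).
move=> A mA.
apply: (measure_unique (@RGenInftyO.G R) (fun n => `]-oo, n%:R[%classic)) => //.
- exact: RGenInftyO.measurableE.
- move=> B C [x ->] [y ->]; exists (Num.min x y).
  apply/seteqP; split => z /=; rewrite !in_itv/= lt_min; first by move=> [-> ->].
  by move/andP.
- by move=> n; exists n%:R.
- apply/seteqP; split => // x _; exists (Num.truncn x).+1 => //=.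
  by rewrite in_itv/= truncnS_gt.
- by move=> B [x ->]; exact: ray.
- by move=> k; rewrite -ge0_fin_numE// fin_num_measure.
Qed.

(** * Characteristic function of the normal law *)

(** The density is a Radon-Nikodym derivative of the law with respect to
    Lebesgue measure, by uniqueness of that derivative almost everywhere. *)
Lemma Rintegral_normal_prob (R : realType) (m s : R) (f : R -> R) :
  s != 0 -> measurable_fun (setT : set (measurableTypeR R)) f -> (forall x, `|f x| <= 1) ->
  \int[normal_prob m s]_x f x = \int[@lebesgue_measure R]_x (f x * normal_pdf m s x).
Proof.
move=> s0 mf f1; congr fine.
have intf : (normal_prob m s).-integrable setT (EFin \o f).
  apply: measurable_bounded_integrable => //.
  - by rewrite -ge0_fin_numE ?fin_num_measure.
  - by exists 1; split => // x x1 w _; apply: le_trans (ltW x1); exact: f1.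
rewrite -(Radon_Nikodym_change_of_variables (normal_prob_dominates m s) measurableT intf)//=.
under [RHS]eq_integral do rewrite EFinM.
apply: ae_eq_integral => //.
- apply: emeasurable_funM; first exact/measurable_EFinP.
  apply: (measurable_int (@lebesgue_measure R)).
  by apply: Radon_Nikodym_integrable; exact: normal_prob_dominates.
- apply: emeasurable_funM; apply/measurable_EFinP => //.
  exact: measurable_normal_pdf.
- apply: ae_eqe_mul2l => /=.
  rewrite Radon_NikodymE//=; first exact: normal_prob_dominates.
  move=> abmu.
  case: cid => /= h [h1 h2 h3].
  apply: integral_ae_eq => //=.
  + by apply/measurable_EFinP; exact: measurable_normal_pdf.
  + by move=> E E01 mE; rewrite -h3.
Qed.

Section gaussian_char.
Context {R : realType} (m s : R).
Hypothesis s0 : s != 0.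
Local Notation mu := (@lebesgue_measure R).

Let phi (f : R -> R) t := \int[mu]_x (f (t * (x - m)) * normal_pdf m s x).

Let phi_cos t : phi cos t = expR (- (s ^+ 2 * t ^+ 2 / 2)).
Proof.
have dN x : is_derive x (1 : R) (fun x : R => - sin x) (- cos x) by apply: is_derive_eq.
have N1 (x : R) : `|- sin x| <= 1 by rewrite normrN sin_max.
by rewrite /phi (gaussian_fourier_trig m s0 (@is_derive_cos R) dN (@cos_max R) N1) cos0 mul1r.
Qed.

Let phi_sin t : phi sin t = 0.
Proof.
have dN x : is_derive x (1 : R) cos (- sin x) by apply: is_derive_eq.
rewrite /phi (gaussian_fourier_trig m s0 (@is_derive_sin R) dN (@sin_max R) (@cos_max R)).
by rewrite sin0 mul0r.
Qed.

Let integrable_trig (h : R -> R) t : continuous h -> (forall x, `|h x| <= 1) ->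
  mu.-integrable setT (EFin \o (fun x => h (t * (x - m)) * normal_pdf m s x)).
Proof.
move=> ch h1; apply: le_integrable (integrable_normal_pdf m s) => //.
  apply/measurable_EFinP; apply: measurable_funM; last exact: measurable_normal_pdf.
  apply: continuous_measurable_fun => x; apply: continuous_comp; last exact: ch.
  by apply: cvgM; [exact: cvg_cst|apply: cvgB; [exact: cvg_id|exact: cvg_cst]].
move=> x _; rewrite /= lee_fin normrM; exact: ler_piMl.
Qed.

Lemma normal_prob_cos t : \int[normal_prob m s]_x cos (t * x) =
  expR (- (s ^+ 2 * t ^+ 2 / 2)) * cos (t * m).
Proof.
rewrite (@Rintegral_normal_prob _ _ _ (fun x => cos (t * x)))//; last 2 first.
- exact: (measurable_cosZ t (@measurable_id _ (measurableTypeR R) setT)).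
- by move=> x; exact: cos_max.
have ic := integrable_trig t (@continuous_cos R) (@cos_max R).
have isn := integrable_trig t (@continuous_sin R) (@sin_max R).
transitivity (\int[mu]_x (cos (t * (x - m)) * normal_pdf m s x * cos (t * m) -
                     sin (t * (x - m)) * normal_pdf m s x * sin (t * m))).
  apply: eq_Rintegral => x _.
  have -> : t * x = t * (x - m) + t * m by ring.
  by rewrite cosD; ring.
rewrite RintegralB//; last 2 first.
- exact: (integrableZr measurableT _ ic).
- exact: (integrableZr measurableT _ isn).
by rewrite !RintegralZr// -/(phi cos t) -/(phi sin t) phi_cos phi_sin mul0r subr0.
Qed.

Lemma normal_prob_sin t : \int[normal_prob m s]_x sin (t * x) =
  expR (- (s ^+ 2 * t ^+ 2 / 2)) * sin (t * m).
Proof.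
rewrite (@Rintegral_normal_prob _ _ _ (fun x => sin (t * x)))//; last 2 first.
- exact: (measurable_sinZ t (@measurable_id _ (measurableTypeR R) setT)).
- by move=> x; exact: sin_max.
have ic := integrable_trig t (@continuous_cos R) (@cos_max R).
have isn := integrable_trig t (@continuous_sin R) (@sin_max R).
transitivity (\int[mu]_x (cos (t * (x - m)) * normal_pdf m s x * sin (t * m) +
                     sin (t * (x - m)) * normal_pdf m s x * cos (t * m))).
  apply: eq_Rintegral => x _.
  have -> : t * x = t * (x - m) + t * m by ring.
  by rewrite sinD; ring.
rewrite RintegralD//; last 2 first.
- exact: (integrableZr measurableT _ ic).
- exact: (integrableZr measurableT _ isn).
by rewrite !RintegralZr// -/(phi cos t) -/(phi sin t) phi_cos phi_sin mul0r addr0.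
Qed.

End gaussian_char.

Lemma is_gaussian_of_char d (Omega : measurableType d) (R : realType)
    (P : probability Omega R) (X : {RV P >-> R}) (m s : R) :
  0 < s ->
  (forall t, \int[P]_w cos (t * X w) = expR (- (s ^+ 2 * t ^+ 2 / 2)) * cos (t * m)) ->
  (forall t, \int[P]_w sin (t * X w) = expR (- (s ^+ 2 * t ^+ 2 / 2)) * sin (t * m)) ->
  is_gaussian X.
Proof.
move=> s_gt0 hc hs; have s0 : s != 0 by rewrite gt_eqF.
exists m, s; split; first exact: ltW.
move=> A mA; rewrite (negbTE s0).
have mid : @measurable_fun _ _ (measurableTypeR R) R setT idfun.
  exact: (@measurable_id _ (measurableTypeR R) setT).
pose Y : {RV (normal_prob m s) >-> R} := @mfun_Sub _ _ (measurableTypeR R) R idfun (mem_set mid).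
rewrite (@distribution_eq_of_char _ _ _ _ _ _ _ X Y) ?preimage_id//.
- by move=> t; rewrite hc -normal_prob_cos.
- by move=> t; rewrite hs -normal_prob_sin.
Qed.

(** * Rigidity under a Gaussian component *)

Section levy_khintchine.
Context d (Omega : measurableType d) (R : realType) (P : probability Omega R).
Variable X : {RV P >-> R}.
Variables (b s2 : R) (nu : {measure set (measurableTypeR R) -> \bar R}).
Hypothesis LK : levy_khintchine_triplet X b s2 nu.

Let K t := \int[nu]_x (1 - cos (t * x)).
Let J t := \int[nu]_x (sin (t * x) - t * x * \1_[set y : R | `|y| <= 1] x).

Lemma cintegral_cexp_imaginary t :
  cintegral P (fun w => cexp (Complex 0 (t * X w))) =
  Complex (\int[P]_w cos (t * X w)) (\int[P]_w sin (t * X w)).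
Proof.
by rewrite /cintegral; congr Complex; apply: eq_Rintegral => w _ /=;
  rewrite expR0 mul1r.
Qed.

Let integrable_min : nu.-integrable setT (fun x : R => (Num.min 1 (x ^+ 2))%:E).
Proof.
have [_ [_ fin] _] := LK; apply/integrableP; split.
  apply/measurable_EFinP; apply: measurable_minr; first exact: measurable_cst.
  by apply: measurable_funX; exact: measurable_id.
under eq_integral do rewrite gee0_abs ?lee_fin ?le_min ?ler01 ?sqr_ge0//.
exact: fin.
Qed.

Let measurable_K t :
  measurable_fun (setT : set (measurableTypeR R)) (fun x : R => 1 - cos (t * x)).
Proof.
apply: measurable_funB; first exact: measurable_cst.
exact: (measurable_cosZ t (@measurable_id _ (measurableTypeR R) setT)).
Qed.

Let min_bound (t x : R) : 1 - cos (t * x) <= (2 + t ^+ 2) * Num.min 1 (x ^+ 2).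
Proof.
rewrite /Num.min; case: ifPn => _.
  by have := cos_geN1 (t * x); have := sqr_ge0 t; lra.
have := one_sub_cos_le (t * x); rewrite exprMn.
have := mulr_ge0 (sqr_ge0 t) (sqr_ge0 x); have := sqr_ge0 x; nra.
Qed.

Let integrable_K t : nu.-integrable setT (EFin \o (fun x : R => 1 - cos (t * x))).
Proof.
apply: le_integrable (integrableZl measurableT (2 + t ^+ 2) integrable_min) => //.
  by apply/measurable_EFinP; exact: measurable_K.
move=> x _; rewrite -EFinM /= lee_fin ger0_norm ?one_sub_cos_ge0//.
by apply: le_trans (ler_norm _); exact: min_bound.
Qed.

(** Real form of the Levy-Khintchine formula: K is the jump part of the
    exponent of the modulus, and b t + J t is the phase. *)
Lemma levy_khintchine_real t :
  \int[P]_w cos (t * X w) = expR (- (s2 * t ^+ 2 / 2) - K t) * cos (b * t + J t) /\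
  \int[P]_w sin (t * X w) = expR (- (s2 * t ^+ 2 / 2) - K t) * sin (b * t + J t).
Proof.
have [_ _ /(_ t)] := LK.
rewrite cintegral_cexp_imaginary /cintegral /cexp /=.
have -> : \int[nu]_w (expR 0 * cos (t * w) - 1 - 0) = - K t.
  rewrite -[RHS]mulN1r /K -RintegralZl//.
  by apply: eq_Rintegral => x _; rewrite expR0; ring.
have -> : \int[nu]_w (expR 0 * sin (t * w) - 0 - t * w * \1_[set y : R | `|y| <= 1] w) = J t.
  by apply: eq_Rintegral => x _; rewrite expR0 mul1r subr0.
by move=> [-> ->].
Qed.

Let K_ge0 t : 0 <= K t.
Proof. by apply: Rintegral_ge0 => x _; exact: one_sub_cos_ge0. Qed.

(** At infinity the jump part of the exponent is negligible against the
    Gaussian part: (1 - cos(u x)) / u^2 tends to 0 pointwise, and for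
    |u| >= u1 it is dominated by a multiple of min(1, x^2). *)
Lemma jump_exponent_negligible (u : nat -> R) (u1 : R) : 0 < u1 ->
  (forall n, u1 <= `|u n|) -> (u n)^-1 @[n --> \oo] --> 0 ->
  K (u n) / u n ^+ 2 @[n --> \oo] --> 0.
Proof.
move=> u10 u1u uV.
have u0 n : u n != 0 by rewrite -normr_gt0; exact: lt_le_trans (u1u n).
have un n : 0 < u n ^+ 2 by rewrite exprn_even_gt0//= u0.
pose c := 1 + 2 / u1 ^+ 2.
have c0 : 0 < 2 / u1 ^+ 2 by rewrite divr_gt0// exprn_gt0.
have mf n : measurable_fun (setT : set (measurableTypeR R))
    (fun x : R => (1 - cos (u n * x)) / u n ^+ 2).
  by apply: measurable_funM; [exact: measurable_K|exact: measurable_cst].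
have m0 : measurable_fun (setT : set (measurableTypeR R)) (fun _ : R => 0 : R).
  exact: measurable_cst.
have ptw (x : measurableTypeR R) : (1 - cos (u n * x)) / u n ^+ 2 @[n --> \oo] --> (0 : R).
  apply: (@cvg0_of_norm_le _ _ (fun n => 2 * ((u n)^-1 * (u n)^-1))) => [n|].
    rewrite normf_div (ger0_norm (one_sub_cos_ge0 _)) (ger0_norm (ltW (un n))).
    rewrite -invfM -expr2 ler_wpM2r ?invr_ge0 ?(ltW (un n))//.
    by have := cos_geN1 (u n * x); lra.
  rewrite [X in _ --> X](_ : _ = 2 * (0 * 0)); last by rewrite !mulr0.
  by apply: cvgM; [exact: cvg_cst|exact: cvgM].
have bnd n (x : measurableTypeR R) : `|(1 - cos (u n * x)) / u n ^+ 2| <= c * Num.min 1 (x ^+ 2).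
  rewrite normf_div (ger0_norm (one_sub_cos_ge0 _)) (ger0_norm (ltW (un n))).
  rewrite /Num.min; case: ifPn => _; last first.
    rewrite ler_pdivrMr//; apply: le_trans (one_sub_cos_le _) _; rewrite exprMn.
    have h := mulr_ge0 (sqr_ge0 (u n)) (sqr_ge0 x).
    by rewrite /c; have := mulr_ge0 (ltW c0) h; lra.
  apply: (@le_trans _ _ (2 / u n ^+ 2)).
    rewrite ler_wpM2r ?invr_ge0 ?(ltW (un n))//.
    by have := cos_geN1 (u n * x); lra.
  apply: (@le_trans _ _ (2 / u1 ^+ 2)); last by rewrite /c; lra.
  have u1n : u1 ^+ 2 <= u n ^+ 2.
    by rewrite -(real_normK (num_real (u n))) ler_sqr ?nnegrE// ltW.
  have u12 : 0 < u1 ^+ 2 by rewrite exprn_gt0.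
  by apply: ler_wpM2l => //; rewrite lef_pV2 ?posrE.
have ic := integrableZl measurableT c integrable_min.
have [_] := @Rdominated_convergence _ _ R nu _ _ _ mf m0 ptw ic bnd.
rewrite Rintegral_cst// mul0r.
by under eq_fun do rewrite RintegralZr//.
Qed.

Hypothesis s2_gt0 : 0 < s2.
Variables (r i : R -> R).
Hypothesis Cr : forall t, \int[P]_w cos (t * X w) = expR (- r t) * cos (i t).
Hypothesis Sr : forall t, \int[P]_w sin (t * X w) = - (expR (- r t) * sin (i t)).

Let rE t : r t = s2 * t ^+ 2 / 2 + K t.
Proof.
have [Ct St] := levy_khintchine_real t.
have sq (x y : R) : (x * cos y) ^+ 2 + (x * sin y) ^+ 2 = x ^+ 2.
  by rewrite !exprMn -mulrDr cos2Dsin2 mulr1.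
have : expR (- r t) ^+ 2 = expR (- (s2 * t ^+ 2 / 2) - K t) ^+ 2.
  rewrite -(sq _ (i t)) -(sq (expR (- (s2 * t ^+ 2 / 2) - K t)) (b * t + J t)).
  by rewrite -Ct -St Cr Sr sqrrN.
move/eqP; rewrite eqrXn2// ?expR_ge0// => /eqP /expR_inj.
lra.
Qed.

Lemma gaussian_part_le t : s2 * t ^+ 2 / 2 <= r t.
Proof. by rewrite rE lerDl K_ge0. Qed.

(** K = 0 makes nu vanish outside 0, so the compensated sine integral J is 0
    too, and the phase is the linear function b t. *)
Lemma levy_khintchine_no_jumps :
  (forall t, K t = 0) -> is_gaussian X.
Proof.
move=> K0.
have : {ae nu, forall x : R, x = 0}.
  apply: (ae_eq0_of_cos (@measurable_id _ (measurableTypeR R) setT)) => t.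
  have : (\int[nu]_x (1 - cos (t * x))%:E)%E = (K t)%:E.
    by rewrite /K /Rintegral fineK//; exact: (integrable_fin_num measurableT (integrable_K t)).
  by rewrite K0.
move=> nu0.
have J0 t : J t = 0.
  rewrite /J -[RHS]/(fine 0%E) -(integral0 nu setT); congr fine.
  apply: ae_eq_integral => //.
  - apply/measurable_EFinP; apply: measurable_funB.
      exact: (measurable_sinZ t (@measurable_id _ (measurableTypeR R) setT)).
    apply: measurable_funM.
      by apply: measurable_funM; [exact: measurable_cst|exact: measurable_id].
    apply: measurable_indic.
    rewrite (_ : [set y : R | _] = `[-1, 1]%classic); last first.
      by apply/seteqP; split => y /=; rewrite in_itv/= ler_norml.
    exact: measurable_itv.
  - have [N [mN N0 subN]] := nu0; exists N; split => // x /= h; apply: subN => /= x0.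
    by apply: h => _; rewrite x0 mulr0 sin0 mul0r subr0.
have sq : Num.sqrt s2 ^+ 2 = s2 by rewrite sqr_sqrtr// ltW.
apply: (@is_gaussian_of_char _ _ _ _ X b (Num.sqrt s2)).
- by rewrite sqrtr_gt0.
- move=> t; have [-> _] := levy_khintchine_real t.
  by rewrite K0 J0 subr0 addr0 sq (mulrC b).
- move=> t; have [_ ->] := levy_khintchine_real t.
  by rewrite K0 J0 subr0 addr0 sq (mulrC b).
Qed.

Variables (l c : R).
Hypothesis c_gt0 : 0 < c.

(** Along the orbit l^n t, which goes to infinity, r(y) / y^2 tends to
    s2 / 2; the scaling then makes r exactly quadratic and leaves nothing for
    the jumps. *)
Lemma levy_khintchine_rigid_gt1 :
  1 < l -> (forall t, r (l * t) = c * r t) -> is_gaussian X.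
Proof.
move=> l1 rl; have l0 : 0 < l by exact: lt_trans l1.
have lne : l != 0 by rewrite gt_eqF.
have lim t : t != 0 -> r (l ^+ n * t) / (l ^+ n * t) ^+ 2 @[n --> \oo] --> s2 / 2.
  move=> t0.
  have nz n : l ^+ n * t != 0 by rewrite mulf_neq0// expf_neq0.
  have -> : (fun n => r (l ^+ n * t) / (l ^+ n * t) ^+ 2) =
      (fun n => s2 / 2 + K (l ^+ n * t) / (l ^+ n * t) ^+ 2).
    by apply/funext => n; rewrite rE; field; rewrite t0 expf_neq0.
  rewrite -[X in _ --> X]addr0; apply: cvgD; first exact: cvg_cst.
  apply: (@jump_exponent_negligible _ `|t|); first by rewrite normr_gt0.
    move=> n; rewrite normrM; apply: ler_peMl => //.
    by rewrite ger0_norm ?exprn_ge0 ?(ltW l0)// exprn_ege1// ltW.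
  have -> : (fun n => (l ^+ n * t)^-1) = (fun n => l^-1 ^+ n * t^-1).
    by apply/funext => n; rewrite invfM exprVn.
  rewrite -[X in _ --> X](mul0r t^-1); apply: cvgM; last exact: cvg_cst.
  by apply: cvg_expr_lt1; rewrite invr_gt0 l0 invf_lt1.
have cl : c = l ^+ 2.
  apply: (scaling_factor_eq lne (oner_neq0 R) _ rl (lim _ (oner_neq0 R))).
  by rewrite gt_eqF// divr_gt0.
apply: levy_khintchine_no_jumps => t; have [->|t0] := eqVneq t 0.
  rewrite /K; under eq_Rintegral do rewrite mul0r cos0 subrr.
  by rewrite Rintegral_cst// mul0r.
have rt : r t = s2 / 2 * t ^+ 2.
  by apply: (scaling_ratio_const lne t0 _ (lim t t0)) => y; rewrite rl cl.
by have := rE t; rewrite rt; lra.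
Qed.

End levy_khintchine.

(** A scaling factor below one is inverted, so that the iterates go to
    infinity. *)
Lemma gaussian_component_rigid d (Omega : measurableType d) (R : realType)
    (P : probability Omega R) (X : {RV P >-> R}) (r i : R -> R) (l c : R) :
  has_gaussian_component X ->
  (forall t, \int[P]_w cos (t * X w) = expR (- r t) * cos (i t)) ->
  (forall t, \int[P]_w sin (t * X w) = - (expR (- r t) * sin (i t))) ->
  0 < l -> 0 < c -> (forall t, r (l * t) = c * r t) ->
  (l = 1 /\ c = 1) \/ is_gaussian X.
Proof.
move=> [b [s2 [nu [LK s2_gt0]]]] Cr Sr l0 c0 rl.
have l0' : l != 0 by rewrite gt_eqF.
have c0' : c != 0 by rewrite gt_eqF.
have [l1|l1|l1] := ltgtP l 1.
- right; apply: (levy_khintchine_rigid_gt1 LK s2_gt0 Cr Sr (l := l^-1) (c := c^-1)).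
    by rewrite invf_gt1.
  by move=> t; rewrite -[in RHS](mulVKf l0' t) rl mulKf.
- by right; exact: (levy_khintchine_rigid_gt1 LK s2_gt0 Cr Sr l1 rl).
- left; split => //.
  have r1 : 0 < r 1.
    apply: lt_le_trans (gaussian_part_le LK Cr Sr 1).
    by rewrite expr1n mulr1 divr_gt0.
  have := rl 1; rewrite l1 mul1r -{1}[r 1]mul1r => /mulIf; rewrite gt_eqF//.
  by move=> /(_ isT).
Qed.

(** * Dilatively stable processes *)

Section dilative_stability.
Context (R : realType) (d : measure_display) (Omega : measurableType d).
Context (P : probability Omega R) (TT : set R) (f g : R -> R) (X : R -> {RV P >-> R}).
Hypothesis hTT : [\/ TT = [set: R], TT = `[0, +oo[%classic | TT = `]0, +oo[%classic].

Lemma index_set_scale T t : 0 < T -> TT t -> TT (T * t).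
Proof.
move=> T0; case: hTT => -> //=; rewrite !in_itv/= !andbT.
  by move=> t0; rewrite mulr_ge0// ltW.
by move=> t0; rewrite mulr_gt0.
Qed.

Lemma index_set1 : TT 1.
Proof. by case: hTT => ->; rewrite //= in_itv/= ?ler01 ?ltr01. Qed.

(** The exponents of the one-dimensional marginals, split into real and
    imaginary parts. *)
Lemma dilatively_stable_exponent : dilatively_stable TT f g X ->
  exists r i : R -> R -> R,
  [/\ forall t, TT t -> forall u,
        \int[P]_w cos (u * X t w) = expR (- r t u) * cos (i t u),
      forall t, TT t -> forall u,
        \int[P]_w sin (u * X t w) = - (expR (- r t u) * sin (i t u)),
      forall T t u, 0 < T -> TT t -> r (T * t) u = g T * r t (f T * u) &
      forall T t u, 0 < T -> TT t -> i (T * t) u = g T * i t (f T * u)].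
Proof.
move=> [_ [psi [psiP psiS]]].
pose p t u := psi 1%N (const_mx t : 'rV[R]_1) (const_mx u : 'rV[R]_1).
exists (fun t u => complex.Re (p t u)), (fun t u => complex.Im (p t u)).
have tt t : TT t -> forall i : 'I_1, TT ((const_mx t : 'rV[R]_1) ord0 i).
  by move=> Tt i; rewrite mxE.
have char t u : TT t ->
    Complex (\int[P]_w cos (u * X t w)) (\int[P]_w sin (u * X t w)) =
    cexp (- p t u).
  move=> Tt; have [_ _ /(_ (const_mx u)) <-] := psiP 1%N (const_mx t) isT (tt t Tt).
  rewrite -cintegral_cexp_imaginary /characteristic_function; congr cintegral.
  by apply/funext => w; rewrite big_ord1 !mxE.
have scal T t u : 0 < T -> TT t ->
    p (T * t) u = Complex (g T) 0 * p t (f T * u).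
  move=> T0 Tt; rewrite /p.
  have -> : (const_mx (T * t) : 'rV[R]_1) = T *: const_mx t.
    by apply/matrixP => j k; rewrite !mxE.
  have -> : (const_mx (f T * u) : 'rV[R]_1) = f T *: const_mx u.
    by apply/matrixP => j k; rewrite !mxE.
  exact: psiS (tt t Tt).
split.
- by move=> t Tt u; move: (char t u Tt); case: (p t u) => a b [-> _] /=; rewrite cosN.
- by move=> t Tt u; move: (char t u Tt); case: (p t u) => a b [_ ->] /=; rewrite sinN mulrN.
- by move=> T t u T0 Tt; rewrite scal//; case: (p t _) => a b /=; rewrite mul0r subr0.
- by move=> T t u T0 Tt; rewrite scal//; case: (p t _) => a b /=; rewrite mul0r addr0.
Qed.

Hypothesis hf : {within `]0, +oo[%classic, continuous f}.
Hypothesis hg : {within `]0, +oo[%classic, continuous g}.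
Hypothesis hf0 : forall x : R, 0 < x -> 0 < f x.
Hypothesis hg0 : forall x : R, 0 < x -> 0 < g x.

Variables r i : R -> R -> R.
Hypothesis rS : forall T t u, 0 < T -> TT t -> r (T * t) u = g T * r t (f T * u).
Hypothesis iS : forall T t u, 0 < T -> TT t -> i (T * t) u = g T * i t (f T * u).

(** The exponent of X_(T S t) is computed in two ways: in one step, and by
    scaling by S and then by T. *)
Lemma scaling_functions_cocycle (h : R -> R -> R) t T S u :
  (forall T t u, 0 < T -> TT t -> h (T * t) u = g T * h t (f T * u)) ->
  TT t -> 0 < T -> 0 < S ->
  g (T * S) * h t (f (T * S) * u) = g T * g S * h t (f T * f S * u).
Proof.
move=> hS Tt T0 S0; rewrite -hS ?mulr_gt0// -mulrA hS//; last exact: index_set_scale.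
by rewrite hS// mulrA [f S * _]mulrA (mulrC (f S)).
Qed.

(** The rigidity hypothesis is applied to the two defects of multiplicativity
    l = f(TS) / (f(T) f(S)) and c = g(T) g(S) / g(TS). *)
Lemma power_laws_of_rigidity :
  (forall l c, 0 < l -> 0 < c -> (forall u, r 1 (l * u) = c * r 1 u) ->
     (forall u, i 1 (l * u) = c * i 1 u) -> l = 1 /\ c = 1) ->
  exists! bg : R * R, is_power f bg.1 /\ is_power g bg.2.
Proof.
move=> rigid.
have scale (h : R -> R -> R) T S u :
    (forall T t u, 0 < T -> TT t -> h (T * t) u = g T * h t (f T * u)) ->
    0 < T -> 0 < S ->
    h 1 (f (T * S) / (f T * f S) * u) = g T * g S / g (T * S) * h 1 u.
  move=> hS T0 S0; have TS0 : 0 < T * S by rewrite mulr_gt0.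
  have := scaling_functions_cocycle ((f T * f S)^-1 * u) hS index_set1 T0 S0.
  have fTS : f T * f S != 0 by rewrite gt_eqF// mulr_gt0// hf0.
  have gTS : g (T * S) != 0 by rewrite gt_eqF// hg0.
  rewrite [f (T * S) * _]mulrA mulVKf// => e.
  by apply: (mulfI gTS); rewrite e; field.
have fg T S : 0 < T -> 0 < S -> f (T * S) = f T * f S /\ g (T * S) = g T * g S.
  move=> T0 S0; have TS0 : 0 < T * S by rewrite mulr_gt0.
  have fTS : 0 < f T * f S by rewrite mulr_gt0// hf0.
  have gTS : 0 < g (T * S) by rewrite hg0.
  have [] := rigid (f (T * S) / (f T * f S)) (g T * g S / g (T * S)).
  - by rewrite divr_gt0// hf0.
  - by rewrite divr_gt0// mulr_gt0// hg0.
  - by move=> u; exact: scale.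
  - by move=> u; exact: scale.
  move=> e1 e2; split.
    by rewrite -[LHS](divfK (lt0r_neq0 fTS)) e1 mul1r.
  by rewrite -[RHS](divfK (lt0r_neq0 gTS)) e2 mul1r.
have [beta fb] := multiplicative_is_power hf hf0 (fun x y x0 y0 => (fg x y x0 y0).1).
have [gamma gc] := multiplicative_is_power hg hg0 (fun x y x0 y0 => (fg x y x0 y0).2).
exists (beta, gamma); split => // -[b c] /= [fb' gc'].
by rewrite (is_power_inj fb fb') (is_power_inj gc gc').
Qed.

Lemma power_law_of_f :
  (exists2 t, TT t & exists u, r t u != 0 \/ i t u != 0) ->
  (exists beta, is_power f beta) -> exists! gamma, is_power g gamma.
Proof.
move=> [t Tt [u ru]] [beta fb].
have fM T S : 0 < T -> 0 < S -> f (T * S) = f T * f S.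
  by move=> T0 S0; rewrite !fb ?mulr_gt0// powRM// ltW.
have gM T S : 0 < T -> 0 < S -> g (T * S) = g T * g S.
  move=> T0 S0.
  have fTS : f T * f S != 0 by rewrite gt_eqF// mulr_gt0// hf0.
  have key (h : R -> R -> R) :
     (forall T t u, 0 < T -> TT t -> h (T * t) u = g T * h t (f T * u)) ->
     h t u != 0 -> g (T * S) = g T * g S.
    move=> hS hu.
    have := scaling_functions_cocycle ((f T * f S)^-1 * u) hS Tt T0 S0.
    by rewrite fM// mulVKf// => /(mulIf hu).
  by case: ru; [exact: key rS|exact: key iS].
have [gamma gc] := multiplicative_is_power hg hg0 gM.
by exists gamma; split => // c gc'; exact: is_power_inj gc gc'.
Qed.

End dilative_stability.

(** If the exponent were 0, all 1 - cos(u X) would have expectation 0, and X would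
    vanish almost surely. *)
Lemma nonzero_exponent d (Omega : measurableType d) (R : realType)
    (P : probability Omega R) (X : {RV P >-> R}) (r i : R -> R) :
  (P (X @^-1` [set 0%R]) < 1)%E ->
  (forall u, \int[P]_w cos (u * X w) = expR (- r u) * cos (i u)) ->
  exists u, r u != 0 \/ i u != 0.
Proof.
move=> PX Cr; apply: contrapT => ri.
have ri0 u : r u = 0 /\ i u = 0.
  by split; apply/eqP/negPn/negP => h; apply: ri; exists u; [left|right].
have int0 t : (\int[P]_w (1 - cos (t * X w))%:E = 0)%E.
  have i1 : P.-integrable setT (EFin \o cst 1) by exact: finite_measure_integrable_cst.
  have iC := integrable_cos X t.
  have P1 : fine ((P : {measure set Omega -> \bar R}) setT) = 1.
    exact: (congr1 fine (probability_setT P)).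
  have fin : (\int[P]_w (1 - cos (t * X w))%:E)%E \is a fin_num.
    exact: (integrable_fin_num measurableT (integrableB measurableT i1 iC)).
  rewrite -(fineK fin); congr EFin.
  rewrite -/(Rintegral P setT (fun w => 1 - cos (t * X w))) RintegralB//.
  by rewrite Rintegral_cst// P1 Cr (ri0 t).1 (ri0 t).2 oppr0 expR0 cos0 !mul1r subrr.
have mX : measurable_fun setT X by [].
have [N [mN N0 subN]] := ae_eq0_of_cos mX int0.
move: PX; rewrite ltNge => /negP; apply.
have mX0 : measurable (X @^-1` [set 0]).
  by rewrite -[X @^-1` _]setTI; apply: measurable_funPT => //; exact: measurable_set1.
have : (P (~` (X @^-1` [set 0%R])) <= P N)%E.
  by apply: le_measure; rewrite ?inE//; exact: measurableC.
rewrite N0 (probability_setC P mX0).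
by rewrite leeBlDr ?fin_num_measure// add0e.
Qed.

Lemma finite_second_moment d (Omega : measurableType d) (R : realType)
    (P : probability Omega R) (X : {RV P >-> R})
    (m := \int[P]_w X w) (v := \int[P]_w (X w ^+ 2)) :
  ('E_P[fun w => (X w ^+ 2)%R] < +oo)%E ->
  [/\ P.-integrable setT (EFin \o (fun w => X w ^+ 2)),
      ('E_P[X] = m%:E)%E & 'V_P[X] = (v - m ^+ 2)%:E].
Proof.
move=> EX2; have fin : (\int[P]_w (X w ^+ 2)%:E < +oo)%E by move: EX2; rewrite unlock.
have X2 : P.-integrable setT (EFin \o (fun w => X w ^+ 2)).
  apply/integrableP; split; first by apply/measurable_EFinP; exact: measurable_funX.
  by under eq_integral do rewrite gee0_abs ?lee_fin ?sqr_ge0//.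
have X1 := integrable_of_sqr X2.
have Em : ('E_P[X] = m%:E)%E.
  by rewrite unlock /m /Rintegral fineK//; exact: integrable_fin_num.
split => //.
have XX : (X * X : Omega -> R) \in Lfun P 1.
  by apply/Lfun1_integrable; apply: eq_integrable X2.
rewrite /variance covarianceE//; try exact/Lfun1_integrable.
rewrite Em -EFinM EFinB; congr (_ - _%:E)%E.
by rewrite unlock /v /Rintegral fineK//; exact: integrable_fin_num.
Qed.

Theorem theorem1p8 (R : realType) (d : measure_display)
    (Omega : measurableType d) (P : probability Omega R)
    (TT : set R) (f g : R -> R) (X : R -> {RV P >-> R})
    (hTT : [\/ TT = [set: R], TT = `[0, +oo[%classic
             | TT = `]0, +oo[%classic])
    (hf : {within `]0, +oo[%classic, continuous f})
    (hg : {within `]0, +oo[%classic, continuous g})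
    (hf0 : forall x : R, 0 < x -> 0 < f x)
    (hg0 : forall x : R, 0 < x -> 0 < g x)
    (hX : dilatively_stable TT f g X) :
  [/\ (exists2 t : R, TT t & (P (X t @^-1` [set 0%R]) < 1)%E) ->
      (exists beta : R, is_power f beta) ->
      exists! gamma : R, is_power g gamma,

      ~ is_gaussian (X 1) ->
      has_gaussian_component (X 1) ->
      exists! bg : R * R, is_power f bg.1 /\ is_power g bg.2,

      ('E_P[fun w => (X 1 w ^+ 2)%R] < +oo)%E ->
      ('E_P[X 1%R] != 0)%E ->
      (0 < 'V_P[X 1%R])%E ->
      exists! bg : R * R, is_power f bg.1 /\ is_power g bg.2 &

      ~ is_gaussian (X 1) ->
      ('E_P[fun w => (X 1 w ^+ 2)%R] < +oo)%E ->
      (0 < 'V_P[X 1%R])%E ->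
      exists! bg : R * R, is_power f bg.1 /\ is_power g bg.2].
Proof.
have [r [i [Cr Sr rS iS]]] := dilatively_stable_exponent hX.
have T1 := index_set1 hTT.
have rigid := power_laws_of_rigidity hTT hf hg hf0 hg0 rS iS.
split.
- move=> [t Tt Xt]; apply: (power_law_of_f hTT hg hf0 hg0 rS iS).
  by exists t => //; exact: nonzero_exponent Xt (Cr t Tt).
- move=> nG gc; apply: rigid => l c l0 c0 rl _.
  by have [] := gaussian_component_rigid gc (Cr 1 T1) (Sr 1 T1) l0 c0 rl.
- move=> EX2 EX0 VX; have [X2 Em Vm] := finite_second_moment EX2.
  apply: rigid => l c l0 c0 rl il.
  rewrite Vm lte_fin in VX.
  have [//|[m0 _]] := finite_variance_rigid X2 VX (Cr 1 T1) (Sr 1 T1) l0 c0 rl il.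
  by move: EX0; rewrite Em m0 eqxx.
- move=> nG EX2 VX; have [X2 Em Vm] := finite_second_moment EX2.
  apply: rigid => l c l0 c0 rl il.
  rewrite Vm lte_fin in VX.
  have [//|[m0 CS]] := finite_variance_rigid X2 VX (Cr 1 T1) (Sr 1 T1) l0 c0 rl il.
  exfalso; apply: nG; rewrite m0 expr0n/= subr0 in VX.
  apply: (@is_gaussian_of_char _ _ _ _ _ 0 (Num.sqrt (\int[P]_w (X 1 w ^+ 2)))).
  + by rewrite sqrtr_gt0.
  + move=> t; rewrite (CS t).1 mulr0 cos0 mulr1 sqr_sqrtr ?(ltW VX)//.
    by congr (expR (- _)); ring.
  + by move=> t; rewrite (CS t).2 mulr0 sin0 mulr0.
Qed.
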